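(* There does not exist any function $\Phi$ on $[0,\infty)$ with $\Phi(t)=o(t^{-3/2})$ as $t\to+\infty$ such that, for each $f^{in}\in L^2(\mathbb T^2\times\mathbb S^1)$, the solution $F$ of the Cauchy problem $$(\partial_t+\omega\cdot\nabla_x-\partial_s)F=\int_{-1}^12P(2s,h|h')F(t,x,R[\theta(h')]\omega,0,h')\,dh',\qquad F(0,x,\omega,s,h)=f^{in}(x,\omega)E(s,h)$$ satisfies, for each $t\ge0$, $$\|F(t)-\langle f^{in}\rangle E\|_{L^2(\mathbb T^2\times\mathbb S^1\times[0,\infty)\times[-1,1])}\le\Phi(t)\|F(0)\|_{L^2(\mathbb T^2\times\mathbb S^1\times[0,\infty)\times[-1,1])},$$ where $\langle\phi\rangle=\frac1{2\pi}\iint_{\mathbb T^2\times\mathbb S^1}\phi\,dx\,d\omega$.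
   Context: $\mathbb T^2=\mathbb R^2/\mathbb Z^2$. $R[\theta]$ is rotation by angle $\theta$, $\theta(h)=\pi-2\arcsin h$. $P(S,h|h')$ is defined by $$P(S,h|h')=\frac{3}{\pi^2 S\eta}\Big((S\eta)\wedge(1-S)_+ +(\eta S-|1-S|)_+ +\big((S-\tfrac12S\eta)\wedge(1+\tfrac12S\eta)-(\tfrac12S+\tfrac12S\zeta)\vee1\big)_+ +\big((S-\tfrac12S\eta)\wedge1-(\tfrac12S+\tfrac12S\zeta)\vee(1-\tfrac12S\eta)\big)_+\Big),$$ $\zeta=\tfrac12|h+h'|$, $\eta=\tfrac12|h-h'|$, $\wedge=\min$, $\vee=\max$, $z_+=\max(z,0)$; $E(s,h)=\int_{2s}^\infty\int_{-1}^1P(\tau,h|h')\,dh'\,d\tau$. The solution of the Cauchy problem is $F(t)=K_tF(0)$, where $(K_t)_{t\ge0}$ is the strongly continuous, positivity-preserving linear contraction semigroup on $L^1(\mathbb T^2\times\mathbb S^1\times[0,\infty)\times[-1,1])$ generated by the equation. *)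

(* Defs.v *)
From HB Require Import structures.
From mathcomp Require Import all_boot all_order all_algebra.
From mathcomp Require Import all_classical all_reals all_analysis.
Set Implicit Arguments. Unset Strict Implicit. Unset Printing Implicit Defensive.
Import Order.TTheory GRing.Theory Num.Theory.
Import numFieldNormedType.Exports.
Local Open Scope classical_set_scope.
Local Open Scope ring_scope.

Section Defs.
Variable R : realType.
Local Notation mu := (@lebesgue_measure R).

(* fractional part: reduction of a coordinate of T^2 = R^2/Z^2 to [0,1) *)
Definition frac (a : R) : R := a - (Num.floor a)%:~R.
Definition modang (a : R) : R := a - (2 * pi) * (Num.floor (a / (2 * pi)))%:~R.

Definition theta (h : R) : R := pi - 2 * asin h.

Definition pos_part (z : R) : R := Num.max z 0.

Definition Pker (S h h' : R) : R :=
  let zeta := `|h + h'| / 2 in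
  let eta := `|h - h'| / 2 in
  3 / (pi ^+ 2 * S * eta) *
  ( Num.min (S * eta) (pos_part (1 - S))
  + pos_part (eta * S - `|1 - S|)
  + pos_part (Num.min (S - S * eta / 2) (1 + S * eta / 2)
              - Num.max (S / 2 + S * zeta / 2) 1)
  + pos_part (Num.min (S - S * eta / 2) 1
              - Num.max (S / 2 + S * zeta / 2) (1 - S * eta / 2)) ).

Definition Efun (s h : R) : R :=
  fine (\int[mu]_(tau in `[(2 * s)%R, +oo[) \int[mu]_(h' in `[(-1)%R, 1%R])
          (Pker tau h h')%:E)%E.

(* Functions on T^2 x S^1 x [0,oo) x [-1,1] are represented as functions of
   (x1, x2, phi, s, h), x = (x1,x2), omega = (cos phi, sin phi); only the values
   on the fundamental domain [0,1)^2 x [0,2pi) x [0,oo) x [-1,1] matter. *)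
Definition phase := R -> R -> R -> R -> R -> R.

Definition L2sq (G : phase) : \bar R :=
  (\int[mu]_(x1 in `[0%R, 1%R]) \int[mu]_(x2 in `[0%R, 1%R])
   \int[mu]_(ph in `[0%R, (2 * pi)%R]) \int[mu]_(s in `[0%R, +oo[)
   \int[mu]_(h in `[(-1)%R, 1%R]) ((G x1 x2 ph s h) ^+ 2)%R%:E)%E.

Definition L2norm (G : phase) : \bar R :=
  match L2sq G with
  | EFin r => (Num.sqrt r)%:E
  | _ => +oo%E
  end.

Definition in_L2_T2S1 (f : R -> R -> R -> R) : Prop :=
  measurable_fun setT (fun p : R * R * R => f p.1.1 p.1.2 p.2) /\
  (\int[mu]_(x1 in `[0%R, 1%R]) \int[mu]_(x2 in `[0%R, 1%R])
   \int[mu]_(ph in `[0%R, (2 * pi)%R]) ((f x1 x2 ph) ^+ 2)%R%:E < +oo)%E.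

Definition avg (f : R -> R -> R -> R) : R :=
  (2 * pi)^-1 * Rintegral mu `[0%R, 1%R] (fun x1 => Rintegral mu `[0%R, 1%R]
     (fun x2 => Rintegral mu `[0%R, (2 * pi)%R] (fun ph => f x1 x2 ph))).

Definition gain_integrand (F : R -> phase) (t x1 x2 ph s h tau h' : R) : R :=
  2 * Pker (2 * (s + (t - tau))) h h' *
  F tau (frac (x1 - (t - tau) * cos ph)) (frac (x2 - (t - tau) * sin ph))
        (modang (ph + theta h')) 0 h'.

(* F is the (mild) solution of the Cauchy problem
     (d_t + omega . grad_x - d_s) F = int_{-1}^1 2 P(2s,h|h') F(t,x,R[theta(h')]omega,0,h') dh'
     F(0,x,omega,s,h) = f(x,omega) E(s,h),
   i.e. F satisfies Duhamel's formula along the characteristics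
   (x,s) -> (x - (t-tau) omega, s + (t - tau)). *)
Definition is_solution (f : R -> R -> R -> R) (F : R -> phase) : Prop :=
  (forall t, 0 <= t ->
     measurable_fun setT (fun p : R * R * R * R * R =>
                            F t p.1.1.1.1 p.1.1.1.2 p.1.1.2 p.1.2 p.2)) /\
  forall t x1 x2 ph s h, 0 <= t -> 0 <= s -> -1 <= h <= 1 ->
    (forall tau, 0 <= tau <= t ->
       mu.-integrable `[(-1)%R, 1%R]
         (fun h' => (gain_integrand F t x1 x2 ph s h tau h')%:E)) /\
    mu.-integrable `[0%R, t]
      (fun tau => (Rintegral mu `[(-1)%R, 1%R] (gain_integrand F t x1 x2 ph s h tau))%:E) /\
    F t x1 x2 ph s h =
      f (frac (x1 - t * cos ph)) (frac (x2 - t * sin ph)) (modang ph)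
        * Efun (s + t) h
      + Rintegral mu `[0%R, t]
          (fun tau => Rintegral mu `[(-1)%R, 1%R] (gain_integrand F t x1 x2 ph s h tau)).

Definition littleo_t32 (Phi : R -> R) : Prop :=
  forall eps : R, 0 < eps -> exists M : R, forall t : R, M <= t ->
    `|Phi t| <= eps * t `^ (- (3%:R / 2)).

End Defs.

(* Main.v *)
(** The proof tests the decay estimate on a narrow beam: initial data [f] equal to the indicator of directions in [(0, e]], independent of [x].  Positivity of the collision gain gives [F t >= f (omega) * E (s + t, h)] for the solution, while the equilibrium [<f> E] has height of order [e] only, so for [e] small (depending on [t]) the free-flight term survives on the beam and [||F t - <f> E||_2 >= (sqrt e / 2) ||E (. + t, .)||_2] up to restricting the domain.  The factor [sqrt e] cancels against [||F 0||_2 = sqrt e ||E||_2].  Since [P (S, h | h')] is at least of order [1 / S] when [1 - h] and [1 + h'] are at most of order [1 / S], the density [E (s, h)] is at least of order [1 / t] for [s] of order [t] and [1 - h] of order [1 / t]; this makes the ratio at least of order [1 / t], which is larger than [t ^ (-3/2)].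

A solution in the sense of Duhamel's formula is obtained as the monotone limit of the Picard iterates. *)
Require Import Defs.
From HB Require Import structures.
From mathcomp Require Import all_boot all_order all_algebra.
From mathcomp Require Import all_classical all_reals all_analysis measurable_realfun.
From mathcomp Require Import ring lra.
Set Implicit Arguments. Unset Strict Implicit. Unset Printing Implicit Defensive.
Import Order.TTheory GRing.Theory Num.Theory.
Import numFieldNormedType.Exports.
Local Open Scope classical_set_scope.
Local Open Scope ring_scope.

(** * Pointwise bounds on the transition kernel *)

Section TransitionKernel.
Variable R : realType.
Implicit Types S h s t : R.

Lemma pos_part_ge0 (z : R) : 0 <= pos_part z.
Proof. by rewrite /pos_part le_max lexx orbT. Qed.

Lemma le_pos_part (z : R) : z <= pos_part z.
Proof. by rewrite /pos_part le_max lexx. Qed.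

Lemma pos_part_le (z c : R) : 0 <= c -> z <= c -> pos_part z <= c.
Proof. by move=> c0 zc; rewrite /pos_part ge_max zc c0. Qed.

(** The last two brackets of the kernel have this shape; one convenient pair out of the four
    differences bounds each of them. *)
Lemma le_min_sub_max (a b c d z : R) :
  (a - c <= z) || (a - d <= z) || (b - c <= z) || (b - d <= z) ->
  Num.min a b - Num.max c d <= z.
Proof.
have ma : Num.min a b <= a by rewrite ge_min lexx.
have mb : Num.min a b <= b by rewrite ge_min lexx orbT.
have mc : c <= Num.max c d by rewrite le_max lexx.
have md : d <= Num.max c d by rewrite le_max lexx orbT.
by move=> /orP[/orP[/orP[H|H]|H]|H]; lra.
Qed.

Lemma Pker_prefactor_ge0 S h h' : 0 <= S ->
  0 <= 3 / (pi ^+ 2 * S * (`|h - h'| / 2)) :> R.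
Proof.
move=> S0; apply: divr_ge0 => //; apply: mulr_ge0; last exact: divr_ge0.
by apply: mulr_ge0 => //; exact: sqr_ge0.
Qed.

Lemma Pker_ge0 S h h' : 0 <= S -> 0 <= Pker S h h'.
Proof.
move=> S0; apply: mulr_ge0; first exact: Pker_prefactor_ge0.
have e0 : 0 <= S * (`|h - h'| / 2) by rewrite mulr_ge0 ?divr_ge0.
by rewrite !addr_ge0 ?pos_part_ge0// le_min e0 pos_part_ge0.
Qed.

(** The four brackets are at most [S * eta], [S * eta], [S * eta / 2] and [S * eta / 2], so
    [S * eta] cancels against the prefactor and [9 / pi ^+ 2] remains, with [pi >= 2]. *)
Lemma Pker_le3 S h h' : 0 <= S -> Pker S h h' <= 3.
Proof.
move=> S0; rewrite /Pker.
set e := `|h - h'| / 2; set z := `|h + h'| / 2.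
have e0 : 0 <= e by rewrite divr_ge0.
have Se0 : 0 <= S * e by rewrite mulr_ge0.
have Sz0 : 0 <= S * z by rewrite mulr_ge0 ?divr_ge0.
have T1 : Num.min (S * e) (pos_part (1 - S)) <= S * e by rewrite ge_min lexx.
have T2 : pos_part (e * S - `|1 - S|) <= S * e.
  by apply: pos_part_le => //; have := normr_ge0 (1 - S); lra.
have T3 : pos_part (Num.min (S - S * e / 2) (1 + S * e / 2)
              - Num.max (S / 2 + S * z / 2) 1) <= S * e / 2.
  apply: pos_part_le; first by lra.
  apply: le_min_sub_max; apply/orP; right; lra.
have T4 : pos_part (Num.min (S - S * e / 2) 1
     - Num.max (S / 2 + S * z / 2) (1 - S * e / 2)) <= S * e / 2.
  apply: pos_part_le; first by lra.
  apply: le_min_sub_max; apply/orP; right; lra.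
have -> : pi ^+ 2 * S * e = pi ^+ 2 * (S * e) by rewrite mulrA.
(* When the denominator vanishes the kernel is [0], because the inverse of [0] is [0]. *)
have [->|Se_neq0] := eqVneq (S * e) 0; first by rewrite mulr0 invr0 mulr0 mul0r.
have Sep : 0 < S * e by rewrite lt_def Se_neq0.
have pi2 : 4 <= pi ^+ 2 :> R by have := pi_ge2 R; nra.
rewrite mulrAC ler_pdivrMr; last by rewrite mulr_gt0//; lra.
nra.
Qed.

(** For [S >= 4] the first and fourth brackets vanish. The other two vanish unless
    [S * eta > S - 2], that is [|h - h'| > 2 - 4 / S], which forces [h'] to within [4 / S] of an
    endpoint. In that case they are at most [1] each and [S * eta >= S / 2]. *)
Lemma Pker_tail S h h' : 4 <= S -> -1 <= h <= 1 -> -1 <= h' <= 1 ->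
  Pker S h h' <= 3 / S /\
  (-1 + 4 / S < h' < 1 - 4 / S -> Pker S h h' = 0).
Proof.
move=> S4 /andP[h1 h2] /andP[h'1 h'2]; rewrite /Pker.
set e := `|h - h'| / 2; set z := `|h + h'| / 2.
have S0 : 0 < S by lra.
have e0 : 0 <= e by rewrite divr_ge0.
have z0 : 0 <= z by rewrite divr_ge0.
have e1 : e <= 1 by rewrite ler_pdivrMr// mul1r ler_norml; lra.
have -> : pos_part (1 - S) = 0 by apply/max_r; lra.
have -> : Num.min (S * e) 0 = 0 by apply/min_r; rewrite mulr_ge0// ltW.
have -> : `|1 - S| = S - 1 by rewrite ler0_norm; lra.
have Sz0 : 0 <= S * z by rewrite mulr_ge0// ltW.
have -> : pos_part (Num.min (S - S * e / 2) 1
     - Num.max (S / 2 + S * z / 2) (1 - S * e / 2)) = 0.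
  apply/max_r; apply: le_min_sub_max; apply/orP; left; apply/orP; right; lra.
have Se1 : S * e <= S by rewrite ler_piMr// ltW.
have T2 : pos_part (e * S - (S - 1)) <= 1 by apply: pos_part_le => //; lra.
have T3 : pos_part (Num.min (S - S * e / 2) (1 + S * e / 2)
     - Num.max (S / 2 + S * z / 2) 1) <= 1.
  by apply: pos_part_le => //; apply: le_min_sub_max; apply/orP; left; apply/orP; right; lra.
have [eS|eS] := lerP (S * e) (S - 2).
  have -> : pos_part (e * S - (S - 1)) = 0 by apply/max_r; lra.
  have -> : pos_part (Num.min (S - S * e / 2) (1 + S * e / 2)
     - Num.max (S / 2 + S * z / 2) 1) = 0.
    apply/max_r; apply: le_min_sub_max; apply/orP; left; apply/orP; right; lra.
  by rewrite !addr0 mulr0; split => //; rewrite divr_ge0// ltW.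
have pi2 : 4 <= pi ^+ 2 :> R by have := pi_ge2 R; nra.
split.
  have Sh : S / 2 <= S * e by lra.
  have D0 : 0 < pi ^+ 2 * (S * e) by rewrite mulr_gt0//; lra.
  have -> : pi ^+ 2 * S * e = pi ^+ 2 * (S * e) by rewrite mulrA.
  rewrite mulrAC ler_pdivrMr// [leRHS]mulrAC ler_pdivlMr//.
  apply: (@le_trans _ _ (6 * S)); last by nra.
  by rewrite ler_wpM2r ?(ltW S0)//; lra.
move=> /andP[h'3 h'4].
have S4E : S * (4 / S) = 4 by field; lra.
have : 2 - 4 / S < `|h - h'|.
  have : S * (2 - 4 / S) < S * `|h - h'| by rewrite mulrBr S4E; rewrite /e in eS; lra.
  by rewrite ltr_pM2l.
by rewrite lter_normr; lra.
Qed.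

(** Here [eta] is within [(24 * t)^-1] of [1], so [S * (1 - eta) <= 1 / 2] and the second bracket,
    which is [1 - S * (1 - eta)] before truncation, is at least [1 / 2]. The other brackets are
    nonnegative and the denominator is at most [16 * (12 * t)]; the quotient of [3 / 2] by [192 * t]
    is the bound. *)
Lemma Pker_near_corner t S h h' : 1 <= t -> 6 * t <= S <= 12 * t ->
  1 - (24 * t)^-1 <= h <= 1 -> -1 <= h' <= -1 + (24 * t)^-1 ->
  (128 * t)^-1 <= Pker S h h'.
Proof.
move=> t1 /andP[S1 S2] /andP[h1 h2] /andP[h'1 h'2].
have t0 : 0 < t by lra.
have aE : (24 * t)^-1 * t = 24^-1 by field; lra.
have a0 : 0 < (24 * t)^-1 by rewrite invr_gt0; lra.
have a1 : (24 * t)^-1 <= 24^-1 by rewrite lef_pV2 ?posrE; lra.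
rewrite /Pker; set z := `|h + h'| / 2.
have -> : `|h - h'| = h - h' by rewrite ger0_norm//; lra.
set e := (h - h') / 2.
have e0 : 0 < e by rewrite /e; lra.
have e1 : e <= 1 by rewrite /e; lra.
have S0 : 0 < S by lra.
have Se : 1 - S * (1 - e) >= 1 / 2.
  have : 1 - e <= (24 * t)^-1 by rewrite /e; lra.
  nra.
set T1 := Num.min _ _; set T3 := pos_part (Num.min _ (1 + _) - _).
set T4 := pos_part (Num.min _ 1 - _).
have T10 : 0 <= T1 by rewrite le_min pos_part_ge0 mulr_ge0// ltW.
have T30 : 0 <= T3 by exact: pos_part_ge0.
have T40 : 0 <= T4 by exact: pos_part_ge0.
have T2 : 1 / 2 <= pos_part (e * S - `|1 - S|).
  apply: le_trans (le_pos_part _); rewrite ler0_norm; lra.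
have pi2 : pi ^+ 2 <= 16 :> R by have := pihalf_lt2 R; have := pi_gt0 R; nra.
have pi0 : 0 < pi ^+ 2 :> R by rewrite exprn_gt0 ?pi_gt0.
have D0 : 0 < pi ^+ 2 * S * e by apply: mulr_gt0 => //; exact: mulr_gt0.
have Dle : pi ^+ 2 * S * e <= 192 * t.
  rewrite (@le_trans _ _ (16 * (12 * t) * 1))//; last by lra.
  apply: ler_pM => //; [by rewrite mulr_ge0 ?ltW|exact: ltW|].
  by apply: ler_pM => //; exact: ltW.
have t128 : 0 < 128 * t by lra.
rewrite mulrAC ler_pdivlMr// ler_pdivrMl//.
set T2' := pos_part (e * S - _) in T2 *.
nra.
Qed.

End TransitionKernel.

(** * Measurability of the kernel *)

Section Measurability.
Context d (T : measurableType d) (R : realType).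
Implicit Types f g k : T -> R.

(** On nonnegative values, zero included, the inverse is the real power with exponent [-1], which is
    measurable. *)
Lemma measurable_inv_ge0 f : (forall x, 0 <= f x) ->
  measurable_fun setT f -> measurable_fun setT (fun x => (f x)^-1).
Proof.
move=> f0 mf.
have -> : (fun x => (f x)^-1) = (fun y => y `^ (-1)) \o f.
  by apply/funext => x /=; rewrite powR_inv1.
by apply: measurableT_comp => //; exact: measurable_powR.
Qed.

Lemma measurable_pos_part f : measurable_fun setT f ->
  measurable_fun setT (fun x => pos_part (f x)).
Proof. by move=> mf; apply: measurable_maxr => //; exact: measurable_cst. Qed.

Lemma measurable_abs f : measurable_fun setT f ->
  measurable_fun setT (fun x => `|f x|).
Proof. by move=> mf; apply: measurableT_comp => //; exact: normr_measurable. Qed.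

Lemma measurable_Pker_ge0 f g k : (forall x, 0 <= f x) ->
  measurable_fun setT f -> measurable_fun setT g -> measurable_fun setT k ->
  measurable_fun setT (fun x => Pker (f x) (g x) (k x)).
Proof.
move=> f0 mf mg mk.
have me : measurable_fun setT (fun x => `|g x - k x| / 2).
  apply: measurable_funM; last exact: measurable_cst.
  by apply: measurable_abs; exact: measurable_funB.
have mz : measurable_fun setT (fun x => `|g x + k x| / 2).
  apply: measurable_funM; last exact: measurable_cst.
  by apply: measurable_abs; exact: measurable_funD.
have mSe := measurable_funM mf me; have mSz := measurable_funM mf mz.
have half (u : T -> R) : measurable_fun setT u -> measurable_fun setT (fun x => u x / 2).
  by move=> mu; apply: measurable_funM => //; exact: measurable_cst.
have mc (c : R) : measurable_fun setT (fun _ : T => c) by exact: measurable_cst.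
rewrite /Pker.
apply: measurable_funM.
  apply: measurable_funM => //; apply: measurable_inv_ge0.
    move=> x; apply: mulr_ge0; last exact: divr_ge0.
    by apply: mulr_ge0 => //; exact: sqr_ge0.
  by apply: measurable_funM => //; exact: measurable_funM.
apply: measurable_funD; last first.
  apply: measurable_pos_part; apply: measurable_funB.
    apply: measurable_minr => //; apply: measurable_funB => //; exact: half.
  apply: measurable_maxr; last by apply: measurable_funB => //; exact: half.
  by apply: measurable_funD; exact: half.
apply: measurable_funD; last first.
  apply: measurable_pos_part; apply: measurable_funB.
    apply: measurable_minr.
      by apply: measurable_funB => //; exact: half.
    by apply: measurable_funD => //; exact: half.
  by apply: measurable_maxr => //; apply: measurable_funD; exact: half.
apply: measurable_funD.
  apply: measurable_minr => //.
  by apply: measurable_pos_part; exact: measurable_funB.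
apply: measurable_pos_part; apply: measurable_funB; first exact: measurable_funM.
by apply: measurable_abs; exact: measurable_funB.
Qed.

(** Truncating the first argument at [0] removes the sign condition, so the kernel can be integrated
    as a function on a whole product space. *)
Lemma measurable_Pker f g k : measurable_fun setT f ->
  measurable_fun setT g -> measurable_fun setT k ->
  measurable_fun setT (fun x => Pker (Num.max 0 (f x)) (g x) (k x)).
Proof.
move=> mf mg mk; apply: measurable_Pker_ge0 => //.
  by move=> x; rewrite le_max lexx.
by apply: measurable_maxr => //; exact: measurable_cst.
Qed.

Lemma measurable_if_itv (a b : T -> R) f g :
  measurable_fun setT a -> measurable_fun setT b ->
  measurable_fun setT f -> measurable_fun setT g ->
  measurable_fun setT (fun x => if a x <= f x <= b x then g x else 0).
Proof.
move=> ma mb mf mg; apply: measurable_fun_ifT => //.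
by apply: measurable_and; exact: measurable_fun_ler.
Qed.

End Measurability.

(** * Parametric integrals and bounds of integrals by constants *)

Section ParametricIntegral.
Context d (X : measurableType d) (R : realType).
Local Notation mu := (@lebesgue_measure R).

Lemma measurable_integral_snd (g : X * R -> \bar R) :
  measurable_fun setT g -> (forall z, (0 <= g z)%E) ->
  measurable_fun setT (fun x => \int[mu]_y g (x, y))%E.
Proof. by move=> mg g0; exact: measurable_fun_fubini_tonelli_F. Qed.

End ParametricIntegral.

Section IntegralBounds.
Variable R : realType.
Local Notation mu := (@lebesgue_measure R).
Implicit Types (D : set R) (f g : R -> \bar R).

Lemma integral_if_itv (a b : R) f :
  (\int[mu]_x (if (a <= x <= b)%R then f x else 0) =
   \int[mu]_(x in `[a, b]) f x)%E.
Proof.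
rewrite [RHS]integral_mkcond; apply: eq_integral => x _.
rewrite patchE; case: ifPn => H; first by rewrite mem_set//= in_itv.
by rewrite memNset//= in_itv/=; exact/negP.
Qed.

Lemma lebesgue_itv_cc (a b : R) : a <= b -> mu `[a, b] = (b - a)%:E.
Proof.
rewrite lebesgue_measure_itv/= lte_fin le_eqVlt => /orP[/eqP->|->//].
by rewrite ltxx subrr.
Qed.

Lemma ge0_integral_le_cst D f (c m : R) : measurable D ->
  measurable_fun D f -> (forall x, D x -> (0 <= f x <= c%:E)%E) ->
  mu D = m%:E -> (\int[mu]_(x in D) f x <= (c * m)%:E)%E.
Proof.
move=> mD mf fc Dm; apply: (@le_trans _ _ (\int[mu]_(x in D) (c%:E))%E).
  apply: ge0_le_integral => //.
  - by move=> x /fc/andP[].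
  - by move=> x /fc/andP[].
by rewrite EFinM -Dm integral_cst.
Qed.

Lemma ge0_integral_ge_cst D A f (c m : R) : measurable D -> measurable A ->
  A `<=` D -> 0 <= c ->
  measurable_fun D f -> (forall x, D x -> (0 <= f x)%E) ->
  (forall x, A x -> (c%:E <= f x)%E) ->
  mu A = m%:E -> ((c * m)%:E <= \int[mu]_(x in D) f x)%E.
Proof.
move=> mD mA AD c0 mf f0 fc Am.
apply: (@le_trans _ _ (\int[mu]_(x in A) f x)%E); last first.
  by apply: ge0_subset_integral.
apply: (@le_trans _ _ (\int[mu]_(x in A) (c%:E))%E).
  by rewrite EFinM -Am integral_cst.
apply: ge0_le_integral => //.
exact: measurable_funS mf.
Qed.

End IntegralBounds.

(** * Finiteness, decay and lower bound of the density [E] *)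

Section InitialDensity.
Variable R : realType.
Local Notation mu := (@lebesgue_measure R).
Implicit Types S h s t : R.

(** The antiderivative [- (1 + x)^-1] tends to [0] at infinity. *)
Lemma integral_inv_sqr1D (a : R) : 0 <= a ->
  (\int[mu]_(x in `[a, +oo[) (((1 + x) ^+ 2)^-1)%:E = ((1 + a)^-1)%:E)%E.
Proof.
move=> a0.
have nz x : a <= x -> shift 1 x != 0 :> R by move=> ax /=; rewrite gt_eqF//; lra.
have cinv x : a <= x -> {for x, continuous (fun y : R => (shift 1 y)^-1)}.
  move=> ax; apply: cvgV; first exact: nz.
  by apply: cvgD; [exact: cvg_id|exact: cvg_cst].
have dF x : a <= x ->
    is_derive x 1 (fun y : R => - (shift 1 y)^-1) ((1 + x) ^+ 2)^-1.
  move=> ax; have D : is_derive x 1 (shift 1 : R -> R) 1 by exact: is_derive_shift.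
  have dV : derivable (fun y : R => (shift 1 y)^-1) x 1.
    by apply: derivableV; [exact: nz|exact: ex_derive].
  apply: DeriveDef; first exact: derivableN.
  rewrite (_ : 'D_1 _ x = - 'D_1 (fun y : R => (shift 1 y)^-1) x); last exact: deriveN.
  rewrite deriveV; [|exact: nz|exact: ex_derive].
  by rewrite derive_val scaleNr opprK [_ *: _]mulr1 /= addrC.
rewrite (@ge0_continuous_FTC2y _ _ (fun y => - (shift 1 y)^-1) _ 0).
- by rewrite -EFinB sub0r opprK /= addrC.
- by move=> x _; rewrite invr_ge0 sqr_ge0.
- apply: continuous_in_subspaceT => x /[!inE]/=; rewrite in_itv/= andbT => ax.
  rewrite (_ : (fun y => _) = (fun y : R => (shift 1 y)^-1 * (shift 1 y)^-1)).
    by apply: cvgM; exact: cinv.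
  by apply/funext => y; rewrite expr2 invfM /= addrC.
- rewrite -oppr0; apply: cvgN.
  apply/(gtr0_cvgV0 _).2; last exact: cvg_addrr.
  by exists 0; split => //= x x0; lra.
- by move=> x /ltW ax; apply: (@ex_derive _ _ _ _ _ _ _ (dF _ ax)).
- by apply: cvg_at_right_filter; apply: cvgN; exact: cinv.
- move=> x; rewrite in_itv/= andbT => /ltW ax.
  by rewrite derive1E; have := dF _ ax => D; rewrite derive_val.
Qed.

Lemma EfunE s h : Efun s h = fine (\int[mu]_(tau in `[(2 * s)%R, +oo[)
  \int[mu]_(h' in `[(-1)%R, 1%R]) (Pker tau h h')%:E)%E.
Proof. by []. Qed.

Local Opaque Pker Efun.

(** The inner integral of [E], extended to negative [S] by truncation so that it is nonnegative and
    jointly measurable on the whole plane. *)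
Definition Pint (S h : R) : \bar R :=
  (\int[mu]_(h' in `[(-1)%R, 1%R]) (Pker (Num.max 0 S) h h')%:E)%E.

Lemma measurable_EFin_Pker S h (D : set R) : measurable D -> 0 <= S ->
  measurable_fun D (fun h' => (Pker S h h')%:E).
Proof.
move=> mD S0; apply/measurable_EFinP; apply: measurable_funTS.
apply: measurable_Pker_ge0 => //; exact: measurable_cst.
Qed.

Lemma Pint_ge0 S h : (0 <= Pint S h)%E.
Proof.
by apply: integral_ge0 => h' _; rewrite lee_fin Pker_ge0// le_max lexx.
Qed.

Lemma PintE S h : 0 <= S ->
  (\int[mu]_(h' in `[(-1)%R, 1%R]) (Pker S h h')%:E)%E = Pint S h.
Proof. by move=> S0; rewrite /Pint max_r. Qed.

Lemma measurable_Pint : measurable_fun setT (fun p : R * R => Pint p.1 p.2).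
Proof.
have -> : (fun p : R * R => Pint p.1 p.2) = (fun p => \int[mu]_h'
    (if -1 <= h' <= 1 then Pker (Num.max 0 p.1) p.2 h' else 0)%:E)%E.
  apply/funext => p; rewrite /Pint -integral_if_itv.
  by apply: eq_integral => x _; case: ifP.
apply: (@measurable_integral_snd _ _ _ (fun q : R * R * R =>
  (if -1 <= q.2 <= 1 then Pker (Num.max 0 q.1.1) q.1.2 q.2 else 0)%:E)).
  apply/measurable_EFinP; apply: measurable_if_itv;
    [exact: measurable_cst|exact: measurable_cst|exact: measurable_snd|].
  apply: measurable_Pker; last exact: measurable_snd.
    by apply: measurableT_comp; [exact: measurable_fst|exact: measurable_fst].
  by apply: measurableT_comp; [exact: measurable_snd|exact: measurable_fst].
by move=> q; case: ifP => // _; rewrite lee_fin Pker_ge0// le_max lexx.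
Qed.

Local Opaque Pint.

Lemma measurable_Pint_comp d (T : measurableType d) (f g : T -> R) :
  measurable_fun setT f -> measurable_fun setT g ->
  measurable_fun setT (fun x => Pint (f x) (g x)).
Proof.
move=> mf mg; pose u x := (f x, g x).
have mu_ : measurable_fun setT u by exact: measurable_fun_pair.
exact: (measurableT_comp measurable_Pint mu_).
Qed.

(** For [S <= 4] the uniform bound [3] on an interval of length [2] gives [6], and
    [(1 + S) ^+ 2 <= 25]. For larger [S] the kernel is at most [3 / S] and lives on two end
    intervals of length [4 / S], which gives [24 / S ^+ 2]. *)
Lemma Pint_le S h : 0 <= S -> -1 <= h <= 1 ->
  (Pint S h <= (150 * ((1 + S) ^+ 2)^-1)%:E)%E.
Proof.
move=> S0 h1; rewrite -PintE//.
have D0 : 0 < (1 + S) ^+ 2 by rewrite exprn_gt0//; lra.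
have [S4|S4] := lerP S 4.
  apply: (@le_trans _ _ (3 * (1 - -1))%:E).
    apply: ge0_integral_le_cst => //.
    - exact: measurable_EFin_Pker.
    - by move=> h' _; rewrite !lee_fin Pker_ge0// Pker_le3.
    - by apply: lebesgue_itv_cc; lra.
  rewrite lee_fin ler_pdivlMr//; nra.
have S4' := ltW S4; have Sp : 0 < S by lra.
have a0 : 0 < 4 / S by rewrite divr_gt0.
have a1 : 4 / S < 1 by rewrite ltr_pdivrMr//; lra.
pose A : set R := `[-1, -1 + 4 / S]%classic; pose B : set R := `[1 - 4 / S, 1]%classic.
have mA : measurable A by exact: measurable_itv.
have mB : measurable B by exact: measurable_itv.
have mI (U : set R) : measurable U ->
    measurable_fun (`[(-1)%R, 1%R] : set R) (fun x => (\1_U x : R)%:E).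
  by move=> mU; apply/measurable_EFinP; exact: measurable_indic.
apply: (@le_trans _ _ (\int[mu]_(h' in `[(-1)%R, 1%R])
   ((3 / S)%:E * ((\1_A h' : R)%:E + (\1_B h' : R)%:E)))%E).
  apply: ge0_le_integral => //.
  - by move=> h' _; rewrite lee_fin Pker_ge0.
  - exact: measurable_EFin_Pker.
  - apply: emeasurable_funM; first exact: measurable_cst.
    by apply: emeasurable_funD; exact: mI.
  move=> h'; rewrite /= in_itv/= => h'1; rewrite -EFinD -EFinM lee_fin.
  have [H1 H2] := Pker_tail S4' h1 h'1; rewrite !indicE.
  have S3 : 0 <= 3 / S by rewrite divr_ge0.
  have [hA|hA] := boolP (h' \in A).
    apply: le_trans H1 _; rewrite ler_peMr//.
    by case: (h' \in B) => /=; lra.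
  have [hB|hB] := boolP (h' \in B).
    by apply: le_trans H1 _; rewrite add0r mulr1.
  rewrite addr0 mulr0 H2//.
  have hA' : ~~ (-1 <= h' <= -1 + 4 / S).
    by apply: contra hA => H; rewrite inE /A /= in_itv.
  have hB' : ~~ (1 - 4 / S <= h' <= 1).
    by apply: contra hB => H; rewrite inE /B /= in_itv.
  by move: hA' hB' h'1; rewrite !negb_and -!ltNge; lra.
rewrite ge0_integralZl//; last 3 first.
- by apply: emeasurable_funD; exact: mI.
- by move=> x _; rewrite -EFinD lee_fin addr_ge0.
- by rewrite lee_fin divr_ge0 ?ltW.
rewrite ge0_integralD//; [|exact: mI|exact: mI].
rewrite !integral_indic//.
have muA : (mu (A `&` `[(-1)%R, 1%R]) <= (4 / S)%:E)%E.
  apply: (@le_trans _ _ (mu A)); first by rewrite le_measure ?inE//; exact: measurableI.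
  by rewrite lebesgue_itv_cc ?lee_fin; lra.
have muB : (mu (B `&` `[(-1)%R, 1%R]) <= (4 / S)%:E)%E.
  apply: (@le_trans _ _ (mu B)); first by rewrite le_measure ?inE//; exact: measurableI.
  by rewrite lebesgue_itv_cc ?lee_fin; lra.
apply: (@le_trans _ _ ((3 / S)%:E * ((4 / S)%:E + (4 / S)%:E))%E).
  by rewrite lee_wpmul2l ?leeD// lee_fin divr_ge0.
rewrite -EFinD -EFinM lee_fin.
rewrite (_ : 3 / S * (4 / S + 4 / S) = 24 / S ^+ 2); last by field; lra.
rewrite ler_pdivlMr// mulrAC ler_pdivrMr ?exprn_gt0//.
have SS : 4 * S <= S * S by rewrite ler_wpM2r// ltW.
by rewrite !expr2; clear -Sp S4 SS; lra.
Qed.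

(** Integrating the quadratic decay of [Pint] from [2 * s] gives a finite value of order
    [(1 + s)^-1]; finiteness shows that [fine] in the definition of [Efun] loses nothing. *)
Lemma Efun_integral : exists2 C : R, 0 < C &
  forall s h, 0 <= s -> -1 <= h <= 1 ->
  [/\ (\int[mu]_(tau in `[(2 * s)%R, +oo[) Pint tau h = (Efun s h)%:E)%E,
   0 <= Efun s h & Efun s h <= C * (1 + s)^-1].
Proof.
have [C C0 PC] : exists2 C : R, 0 < C & forall S h, 0 <= S -> -1 <= h <= 1 ->
    (Pint S h <= (C * ((1 + S) ^+ 2)^-1)%:E)%E.
  by exists 150 => //; exact: Pint_le.
exists C => // s h s0 h1.
have E0 : (\int[mu]_(tau in `[(2 * s)%R, +oo[) Pint tau h =
  \int[mu]_(tau in `[(2 * s)%R, +oo[) \int[mu]_(h' in `[(-1)%R, 1%R])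
          (Pker tau h h')%:E)%E.
  apply: eq_integral => tau; rewrite inE/= in_itv/= andbT => ts.
  by rewrite PintE//; lra.
have I0 : (0 <= \int[mu]_(tau in `[(2 * s)%R, +oo[) Pint tau h)%E.
  by apply: integral_ge0 => tau _; exact: Pint_ge0.
have I1 : (\int[mu]_(tau in `[(2 * s)%R, +oo[) Pint tau h <= (C * (1 + s)^-1)%:E)%E.
  apply: (@le_trans _ _ (\int[mu]_(tau in `[(2 * s)%R, +oo[)
       (C%:E * (((1 + tau) ^+ 2)^-1)%:E))%E).
    apply: ge0_le_integral; first exact: measurable_itv.
    - by move=> tau _; exact: Pint_ge0.
    - apply: measurable_funTS.
      by apply: measurable_Pint_comp; [exact: measurable_id|exact: measurable_cst].
    - apply: emeasurable_funM; first exact: measurable_cst.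
      apply/measurable_EFinP/measurable_funTS.
      apply: measurable_inv_ge0; first by move=> x; exact: sqr_ge0.
      by apply: measurable_funX; apply: measurable_funD => //; exact: measurable_cst.
    - move=> tau; rewrite /= in_itv/= andbT => ts; rewrite -EFinM.
      apply: PC; [lra|exact: h1].
  have mi : measurable_fun (`[2 * s, +oo[ : set R)
      (fun tau => (((1 + tau) ^+ 2)^-1)%:E).
    apply/measurable_EFinP/measurable_funTS.
    apply: measurable_inv_ge0; first by move=> x; exact: sqr_ge0.
    by apply: measurable_funX; apply: measurable_funD => //; exact: measurable_cst.
  rewrite (@ge0_integralZl _ _ _ mu _ (measurable_itv `[2 * s, +oo[) _ mi); first last.
  - by rewrite lee_fin ltW.
  - by move=> tau _; rewrite lee_fin invr_ge0 sqr_ge0.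
  rewrite integral_inv_sqr1D; last by lra.
  rewrite -EFinM lee_fin; apply: ler_wpM2l; first exact: ltW.
  by rewrite lef_pV2 ?posrE; lra.
have fin : (\int[mu]_(tau in `[(2 * s)%R, +oo[) Pint tau h)%E \is a fin_num.
  by rewrite ge0_fin_numE; [apply: le_lt_trans I1 _; rewrite ltry|exact: I0].
have EE : (\int[mu]_(tau in `[(2 * s)%R, +oo[) Pint tau h = (Efun s h)%:E)%E.
  transitivity (fine (\int[mu]_(tau in `[(2 * s)%R, +oo[) Pint tau h)%E)%:E.
    by symmetry; exact: fineK fin.
  by rewrite EfunE -E0.
by split; [exact: EE|rewrite -lee_fin -EE; exact: I0|rewrite -lee_fin -EE; exact: I1].
Qed.

(** The variable endpoint [2 * s] is turned into a case distinction in the integrand, so that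
    Tonelli applies on a fixed domain. *)
Lemma measurable_Efun : measurable_fun setT (fun p : R * R => Efun (Num.max 0 p.1) p.2).
Proof.
have -> : (fun p : R * R => Efun (Num.max 0 p.1) p.2) = (fun p => fine (\int[mu]_tau
   (if (2 * Num.max 0 p.1 <= tau)%R then Pint tau p.2 else 0)))%E.
  apply/funext => p; rewrite EfunE integral_mkcond; congr fine.
  apply: eq_integral => tau _; rewrite patchE.
  have m0 : 0 <= Num.max 0 p.1 by rewrite le_max lexx.
  case: ifPn => [|H]; first by rewrite inE/= in_itv/= andbT => H; rewrite H PintE//; lra.
  by rewrite ifN//; apply: contra H => H; rewrite mem_set//= in_itv/= andbT.
apply: measurableT_comp; first exact: fine_measurable.
apply: (@measurable_integral_snd _ _ _ (fun q : R * R * R =>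
  if 2 * Num.max 0 q.1.1 <= q.2 then Pint q.2 q.1.2 else 0%E)).
  apply: measurable_fun_ifT; last exact: measurable_cst.
    apply: measurable_fun_ler; last exact: measurable_snd.
    apply: measurable_funM; first exact: measurable_cst.
    apply: measurable_maxr; first exact: measurable_cst.
    by apply: measurableT_comp; [exact: measurable_fst|exact: measurable_fst].
  apply: measurable_Pint_comp; first exact: measurable_snd.
  by apply: measurableT_comp; [exact: measurable_snd|exact: measurable_fst].
by move=> q; case: ifP => // _; exact: Pint_ge0.
Qed.

(** Since [2 * s <= 6 * t], the domain of integration contains [tau] in [[6 * t, 12 * t]] and [h']
    within [(24 * t)^-1] of [-1], where the kernel is at least [(128 * t)^-1]. *)
Lemma Efun_lower : exists2 c : R, 0 < c & forall t s h,
  1 <= t -> 2 * t <= s <= 3 * t ->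
  1 - (24 * t)^-1 <= h <= 1 -> c / t <= Efun s h.
Proof.
exists (6 / 24 / 128); first by rewrite !divr_gt0.
move=> t s h t1 s23 h1; have t0 : 0 < t by lra.
have a0 : 0 < (24 * t)^-1 by rewrite invr_gt0; lra.
have a1 : (24 * t)^-1 <= 24^-1 by rewrite lef_pV2 ?posrE; lra.
have s0 : 0 <= s by lra.
have h11 : -1 <= h <= 1 by lra.
have [C _ /(_ _ _ s0 h11)[EE _ _]] := Efun_integral.
(* Splits the constant into kernel bound, length of the [h'] interval and length of the [tau]
   interval, in the order in which the two integrals consume them. *)
have scale (a b c : R) : a != 0 -> b != 0 ->
    c / a / b / t = (b * t)^-1 * (a * t)^-1 * (c * t).
  by move=> a_neq0 b_neq0; field; rewrite a_neq0 b_neq0 gt_eqF.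
rewrite -lee_fin -EE scale //.
apply: (@ge0_integral_ge_cst _ _ `[6 * t, 12 * t]%classic) => //.
- by move=> x /=; rewrite !in_itv/= andbT; lra.
- by rewrite mulr_ge0 ?invr_ge0//; lra.
- apply: measurable_funTS.
  by apply: measurable_Pint_comp; [exact: measurable_id|exact: measurable_cst].
- by move=> x _; exact: Pint_ge0.
- move=> S; rewrite /= in_itv/= => St; rewrite -PintE; last by lra.
  apply: (@ge0_integral_ge_cst _ _ `[-1, -1 + (24 * t)^-1]%classic) => //.
  - by move=> x /=; rewrite !in_itv/=; lra.
  - by rewrite invr_ge0; lra.
  - by apply: measurable_EFin_Pker => //; lra.
  - by move=> x _; rewrite lee_fin Pker_ge0//; lra.
  - by move=> h'; rewrite /= in_itv/= => h'1; rewrite lee_fin; exact: Pker_near_corner.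
  - by rewrite lebesgue_itv_cc; [congr (_%:E); lra|lra].
- by rewrite lebesgue_itv_cc; [congr (_%:E); lra|lra].
Qed.

End InitialDensity.

(** * Picard iteration for a positive integral operator *)

Section MonotoneFixpoint.
Context d (X : measurableType d) (R : realType).
Local Notation mu := (@lebesgue_measure R).
Variables (w : X -> R -> R -> R) (kap : X -> R -> R -> X) (b : X -> R).
Hypothesis mw : measurable_fun setT (fun q : X * R * R => w q.1.1 q.1.2 q.2).
Hypothesis mkap : measurable_fun setT (fun q : X * R * R => kap q.1.1 q.1.2 q.2).
Hypothesis mb : measurable_fun setT b.
Hypothesis w0 : forall x t h, 0 <= w x t h.
Hypothesis b0 : forall x, 0 <= b x.
Local Open Scope ereal_scope.

(** An abstract collision operator: [w] is the jump density and [kap] the point at which the unknown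
    is evaluated. Extended real values allow monotone convergence before finiteness is known. *)
Definition gain (g : X -> \bar R) (x : X) : \bar R :=
  \int[mu]_t \int[mu]_h ((w x t h)%:E * g (kap x t h)).

Section Gain.
Variable g : X -> \bar R.
Hypothesis mg : measurable_fun setT g.
Hypothesis g0 : forall x, 0 <= g x.

Lemma gain_integrand_ge0 x t h : 0 <= (w x t h)%:E * g (kap x t h).
Proof. by rewrite mule_ge0// lee_fin. Qed.

Lemma measurable_gain_integrand :
  measurable_fun setT (fun q : X * R * R =>
    (w q.1.1 q.1.2 q.2)%:E * g (kap q.1.1 q.1.2 q.2)).
Proof.
apply: emeasurable_funM; first exact/measurable_EFinP.
exact: (measurableT_comp mg mkap).
Qed.

Lemma measurable_gain_inner :
  measurable_fun setT (fun q : X * R =>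
    \int[mu]_h ((w q.1 q.2 h)%:E * g (kap q.1 q.2 h))).
Proof.
apply: (measurable_integral_snd measurable_gain_integrand) => q.
exact: gain_integrand_ge0.
Qed.

Lemma gain_inner_ge0 x t : 0 <= \int[mu]_h ((w x t h)%:E * g (kap x t h)).
Proof. by apply: integral_ge0 => h _; exact: gain_integrand_ge0. Qed.

Lemma measurable_gain : measurable_fun setT (gain g).
Proof.
apply: (measurable_integral_snd measurable_gain_inner) => q.
exact: gain_inner_ge0.
Qed.

Lemma gain_ge0 x : 0 <= gain g x.
Proof. by apply: integral_ge0 => t _; exact: gain_inner_ge0. Qed.

Lemma measurable_gain_integrand1 x t :
  measurable_fun setT (fun h => (w x t h)%:E * g (kap x t h)).
Proof.
exact: (measurableT_comp measurable_gain_integrand (pair1_measurable (x, t))).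
Qed.

Lemma measurable_gain_inner1 x :
  measurable_fun setT (fun t => \int[mu]_h ((w x t h)%:E * g (kap x t h))).
Proof.
exact: (measurableT_comp measurable_gain_inner (pair1_measurable x)).
Qed.

End Gain.

Lemma le_gain (g1 g2 : X -> \bar R) : measurable_fun setT g1 ->
  measurable_fun setT g2 -> (forall x, 0 <= g1 x) -> (forall x, g1 x <= g2 x) ->
  forall x, gain g1 x <= gain g2 x.
Proof.
move=> m1 m2 g10 g12 x.
have g20 y : 0 <= g2 y by exact: le_trans (g10 y) (g12 y).
apply: ge0_le_integral.
- exact: measurableT.
- by move=> t _; exact: gain_inner_ge0.
- exact: measurable_gain_inner1.
- exact: measurable_gain_inner1.
move=> t _; apply: ge0_le_integral.
- exact: measurableT.
- by move=> h _; exact: gain_integrand_ge0.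
- exact: measurable_gain_integrand1.
- exact: measurable_gain_integrand1.
by move=> h _; apply: lee_wpmul2l; [rewrite lee_fin|exact: g12].
Qed.

(** Starting from [0] makes the iterates increase, because [b] is nonnegative and [gain] is
    monotone. *)
Definition picard (n : nat) : X -> \bar R :=
  iter n (fun g x => (b x)%:E + gain g x) (fun=> 0).

Lemma picardS n x : picard n.+1 x = (b x)%:E + gain (picard n) x.
Proof. by []. Qed.

Lemma picard_measurable_ge0 n :
  measurable_fun setT (picard n) /\ forall x, 0 <= picard n x.
Proof.
elim: n => [|n [mn n0]]; first by split => //; exact: measurable_cst.
split.
  by apply: emeasurable_funD; [exact/measurable_EFinP|exact: measurable_gain].
by move=> x; rewrite picardS adde_ge0 ?lee_fin// gain_ge0.
Qed.

Lemma picard_nondecreasing x : nondecreasing_seq (picard ^~ x).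
Proof.
apply/nondecreasing_seqP => n; elim: n x => [|n IH] x.
  exact: (picard_measurable_ge0 1).2.
rewrite 2!picardS; apply: leeD => //; apply: le_gain => //.
- exact: (picard_measurable_ge0 n).1.
- exact: (picard_measurable_ge0 n.+1).1.
- exact: (picard_measurable_ge0 n).2.
Qed.

Definition picard_lim (x : X) : \bar R := limn (picard ^~ x).

Lemma is_cvg_picard x : cvgn (picard ^~ x).
Proof. by apply: ereal_nondecreasing_is_cvgn; exact: picard_nondecreasing. Qed.

Lemma picard_lim_ge0 x : 0 <= picard_lim x.
Proof.
apply: lime_ge; first exact: is_cvg_picard.
by apply: nearW => n; exact: (picard_measurable_ge0 n).2.
Qed.

Lemma measurable_picard_lim : measurable_fun setT picard_lim.
Proof.
apply: (emeasurable_fun_cvg picard).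
  by move=> n; exact: (picard_measurable_ge0 n).1.
by move=> x _; exact: is_cvg_picard.
Qed.

(** Monotone convergence is applied twice, in the inner variable and then in the outer one. *)
Lemma gain_picard_lim x : gain picard_lim x = limn (fun n => gain (picard n) x).
Proof.
rewrite /gain.
transitivity (\int[mu]_t limn (fun n =>
    \int[mu]_h ((w x t h)%:E * picard n (kap x t h)))).
  apply: eq_integral => t _.
  transitivity (\int[mu]_h limn (fun n => (w x t h)%:E * picard n (kap x t h))).
    apply: eq_integral => h _; symmetry; apply: limeMl => //.
    exact: is_cvg_picard.
  apply: monotone_convergence => //.
  - move=> n; apply: measurable_gain_integrand1.
    exact: (picard_measurable_ge0 n).1.
  - by move=> n h _; apply: gain_integrand_ge0; exact: (picard_measurable_ge0 n).2.
  - move=> h _ m n mn; apply: lee_wpmul2l; first by rewrite lee_fin.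
    exact: picard_nondecreasing.
apply: monotone_convergence => //.
- move=> n; have [mn n0] := picard_measurable_ge0 n.
  exact: measurable_gain_inner1.
- by move=> n t _; apply: gain_inner_ge0; exact: (picard_measurable_ge0 n).2.
- move=> t _ m n mn; have [mm m0] := picard_measurable_ge0 m.
  have [mn' n0] := picard_measurable_ge0 n.
  apply: ge0_le_integral => //.
  - by move=> h _; exact: gain_integrand_ge0.
  - exact: measurable_gain_integrand1.
  - exact: measurable_gain_integrand1.
  move=> h _; apply: lee_wpmul2l; first by rewrite lee_fin.
  exact: picard_nondecreasing.
Qed.

Lemma picard_limE x : picard_lim x = (b x)%:E + gain picard_lim x.
Proof.
apply/cvg_lim => //; rewrite -cvg_shiftS /=.
rewrite gain_picard_lim; apply: cvgeD => //.
  exact: cvg_cst.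
apply: ereal_nondecreasing_is_cvgn => m n mn; apply: le_gain.
- exact: (picard_measurable_ge0 m).1.
- exact: (picard_measurable_ge0 n).1.
- exact: (picard_measurable_ge0 m).2.
by move=> y; exact: picard_nondecreasing.
Qed.

(** A supersolution dominates every iterate by induction, hence the limit; this is how finiteness is
    obtained later. *)
Lemma picard_lim_le (G : X -> \bar R) : measurable_fun setT G ->
  (forall x, 0 <= G x) -> (forall x, (b x)%:E + gain G x <= G x) ->
  forall x, picard_lim x <= G x.
Proof.
move=> mG G0 GE x; apply: lime_le; first exact: is_cvg_picard.
apply: nearW => n; elim: n x => [|n IH] x; first exact: G0.
apply: le_trans (GE x); rewrite picardS; apply: leeD => //; apply: le_gain => //.
- exact: (picard_measurable_ge0 n).1.
- exact: (picard_measurable_ge0 n).2.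
Qed.

End MonotoneFixpoint.

(** * Angle reduction, scattering angle and an exponential integral *)

Section AngleMaps.
Variable R : realType.
Local Notation mu := (@lebesgue_measure R).

Lemma measurable_modang : measurable_fun setT (@modang R).
Proof.
apply: measurable_funB; first exact: measurable_id.
apply: measurable_funM; first exact: measurable_cst.
apply: nondecreasing_measurable; first exact: measurableT.
move=> x y xy; rewrite ler_int; apply: le_floor.
by rewrite ler_pM2r// invr_gt0 mulr_gt0// pi_gt0.
Qed.

Lemma modang_id (ph : R) : 0 <= ph < 2 * pi -> modang ph = ph.
Proof.
move=> /andP[ph0 ph1]; have pi20 : 0 < 2 * pi :> R by rewrite mulr_gt0// pi_gt0.
rewrite /modang (_ : Num.floor (ph / (2 * pi)) = 0) ?mulr0 ?subr0//.
by apply: floor_def; rewrite /= divr_ge0 ?(ltW pi20)//= add0r ltr_pdivrMr// mul1r.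
Qed.

Lemma modang_2pi : modang (2 * pi) = 0 :> R.
Proof.
have pi20 : 2 * pi != 0 :> R by rewrite gt_eqF// mulr_gt0// pi_gt0.
by rewrite /modang divff// floor1 mulr1 subrr.
Qed.

(* [asin] is arbitrary outside [-1, 1]; clamping its argument makes [theta] monotone on the whole line. *)
Definition clamped_theta (h : R) : R := theta (Num.max (-1) (Num.min 1 h)).

Lemma clamped_thetaE (h : R) : -1 <= h <= 1 -> clamped_theta h = theta h.
Proof. by move=> /andP[h1 h2]; rewrite /clamped_theta min_r// max_r. Qed.

Lemma le_asin (x y : R) : -1 <= x <= 1 -> -1 <= y <= 1 -> x <= y ->
  asin x <= asin y.
Proof.
move=> x1 y1; rewrite !leNgt; apply: contraNN => yx.
have [[xb sx] [yb sy]] := (asin_def x1, asin_def y1).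
by rewrite -sx -sy ltr_sin ?in_itv.
Qed.

Lemma measurable_clamped_theta : measurable_fun setT clamped_theta.
Proof.
apply: measurable_funB; first exact: measurable_cst.
apply: measurable_funM; first exact: measurable_cst.
apply: nondecreasing_measurable; first exact: measurableT.
move=> x y xy; apply: le_asin.
- by rewrite le_max lexx /= ge_max ge_min lexx andbT; lra.
- by rewrite le_max lexx /= ge_max ge_min lexx andbT; lra.
- rewrite ge_max !le_max lexx /=; apply/orP; right.
  by rewrite le_min !ge_min lexx xy orbT.
Qed.

(** This identity closes the exponential supersolution estimate. The degenerate interval [t = 0] is
    treated apart from the fundamental theorem of calculus. *)
Lemma integral_expR_0t (K M t : R) : 0 <= t ->
  (\int[mu]_(x in `[0%R, t]) (M * K * expR (K * x))%R%:E =
   (M * expR (K * t) - M)%R%:E)%E.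
Proof.
rewrite le_eqVlt => /orP[/eqP <-|t0].
  by rewrite set_itv1 integral_set1 mulr0 expR0 mulr1 subrr.
have dF (x : R) :
    is_derive x 1 (fun y : R => M * expR (K * y)) (M * K * expR (K * x)).
  have dK : is_derive x 1 (fun y : R => K * y) K.
    by apply: (is_derive_eq (is_deriveZ K (is_derive_id x 1))); rewrite [_ *: _]mulr1.
  have dE := is_derive1_comp (is_derive_expR (K * x)) dK.
  apply: (is_derive_eq (is_deriveZ M dE)).
  by rewrite /GRing.scale/= mulrAC mulrA.
have cF (x : R) : {for x, continuous (fun y : R => M * expR (K * y))}.
  apply: differentiable_continuous; apply/derivable1_diffP.
  exact: ex_derive.
rewrite (@continuous_FTC2 _ _ (fun y : R => M * expR (K * y))) //.
- by rewrite mulr0 expR0 mulr1 -EFinB.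
- apply: continuous_in_subspaceT => x _.
  rewrite (_ : (fun y => _) = (fun y : R => K * (M * expR (K * y)))).
    by apply: cvgM; [exact: cvg_cst|exact: cF].
  by apply/funext => y; ring.
- split; first by move=> x _; exact: ex_derive.
    by apply: cvg_at_right_filter; exact: cF.
  by apply: cvg_at_left_filter; exact: cF.
- by move=> x _; rewrite derive1E derive_val.
Qed.

End AngleMaps.

(** * Duhamel's equation for data depending only on the direction *)

Section ConcreteSolution.
Variable R : realType.
Local Notation mu := (@lebesgue_measure R).
Variable a : R -> R.
Hypothesis ma : measurable_fun setT a.
Hypothesis a01 : forall ph, 0 <= a ph <= 1.

(** Data independent of position give a solution independent of position, so a state consists of
    time, direction angle, flight variable and impact parameter only. *)
Let X := (R * R * R * R)%type.
Local Notation time x := (x.1.1.1).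
Local Notation ang x := (x.1.1.2).
Local Notation fly x := (x.1.2).
Local Notation imp x := (x.2).

(* The case distinctions and [Num.max 0] extend the collision kernel of Duhamel's formula, integrated over [0 <= tau <= t] and [-1 <= h' <= 1], to a nonnegative measurable function on the whole space. *)
Definition jump_weight (x : X) (tau h' : R) : R :=
  if 0 <= tau <= time x then
    if -1 <= h' <= 1 then
      2 * Pker (Num.max 0 (2 * (fly x + (time x - tau)))) (imp x) h'
    else 0
  else 0.

Definition jump_target (x : X) (tau h' : R) : X :=
  (tau, modang (ang x + clamped_theta h'), 0, h').

Definition free_flight (x : X) : R :=
  if -1 <= imp x <= 1 then
    a (modang (ang x)) * Efun (Num.max 0 (fly x + time x)) (imp x)
  else 0.

Lemma max0_ge0 (z : R) : 0 <= Num.max 0 z.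
Proof. by rewrite le_max lexx. Qed.

Let mtime : measurable_fun setT (fun x : X => time x).
Proof.
by apply: measurableT_comp => //; apply: measurableT_comp.
Qed.

Let mang : measurable_fun setT (fun x : X => ang x).
Proof.
by apply: measurableT_comp => //; apply: measurableT_comp.
Qed.

Let mfly : measurable_fun setT (fun x : X => fly x).
Proof. exact: measurableT_comp. Qed.

Let mimp : measurable_fun setT (fun x : X => imp x).
Proof. exact: measurable_snd. Qed.

Let mfst2 : measurable_fun setT (fun q : X * R * R => q.1.1).
Proof. exact: measurableT_comp. Qed.

Let mfst1 : measurable_fun setT (fun q : X * R * R => q.1.2).
Proof. exact: measurableT_comp. Qed.

Let mcomp (f : X -> R) : measurable_fun setT f ->
  measurable_fun setT (fun q : X * R * R => f q.1.1).
Proof. by move=> mf; exact: (measurableT_comp mf mfst2). Qed.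

Lemma jump_weight_ge0 x tau h' : 0 <= jump_weight x tau h'.
Proof.
rewrite /jump_weight; case: ifP => // _; case: ifP => // _.
by apply: mulr_ge0 => //; apply: Pker_ge0; exact: max0_ge0.
Qed.

Lemma measurable_jump_weight :
  measurable_fun setT (fun q : X * R * R => jump_weight q.1.1 q.1.2 q.2).
Proof.
apply: measurable_if_itv.
- exact: measurable_cst.
- exact: (mcomp mtime).
- exact: mfst1.
apply: measurable_if_itv.
- exact: measurable_cst.
- exact: measurable_cst.
- exact: measurable_snd.
apply: measurable_funM; first exact: measurable_cst.
apply: measurable_Pker.
- apply: measurable_funM; first exact: measurable_cst.
  apply: measurable_funD; first exact: (mcomp mfly).
  by apply: measurable_funB; [exact: (mcomp mtime)|exact: mfst1].
- exact: (mcomp mimp).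
- exact: measurable_snd.
Qed.

Lemma measurable_jump_target :
  measurable_fun setT (fun q : X * R * R => jump_target q.1.1 q.1.2 q.2).
Proof.
have mth : measurable_fun setT (fun q : X * R * R => clamped_theta q.2).
  exact: (measurableT_comp (@measurable_clamped_theta R) measurable_snd).
apply: measurable_fun_pair; last exact: measurable_snd.
apply: measurable_fun_pair; last exact: measurable_cst.
apply: measurable_fun_pair; first exact: mfst1.
apply: (measurableT_comp (@measurable_modang R)).
by apply: measurable_funD; [exact: (mcomp mang)|exact: mth].
Qed.

Lemma free_flight_ge0 x : 0 <= free_flight x.
Proof.
rewrite /free_flight; case: ifP => // h1; apply: mulr_ge0.
  by case/andP: (a01 (modang (ang x))).
have [C _ /(_ _ _ (max0_ge0 (fly x + time x)) h1)] := Efun_integral R.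
by case.
Qed.

Lemma measurable_free_flight : measurable_fun setT free_flight.
Proof.
apply: measurable_if_itv.
- exact: measurable_cst.
- exact: measurable_cst.
- exact: mimp.
apply: measurable_funM.
  have mm : measurable_fun setT (fun x : X => modang (ang x)).
    exact: (measurableT_comp (@measurable_modang R) mang).
  exact: (measurableT_comp ma mm).
have mp : measurable_fun setT (fun x : X => (fly x + time x, imp x)).
  by apply: measurable_fun_pair; [exact: measurable_funD|exact: mimp].
exact: (measurableT_comp (@measurable_Efun R) mp).
Qed.

(** Possibly infinite at this stage; [sol_le] supplies finiteness. *)
Definition sol : X -> \bar R := picard_lim jump_weight jump_target free_flight.

Lemma sol_ge0 x : (0 <= sol x)%E.
Proof.
apply: picard_lim_ge0.
- exact: measurable_jump_weight.
- exact: measurable_jump_target.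
- exact: measurable_free_flight.
- exact: jump_weight_ge0.
- exact: free_flight_ge0.
Qed.

Lemma measurable_sol : measurable_fun setT sol.
Proof.
apply: measurable_picard_lim.
- exact: measurable_jump_weight.
- exact: measurable_jump_target.
- exact: measurable_free_flight.
- exact: jump_weight_ge0.
- exact: free_flight_ge0.
Qed.

Lemma solE x : sol x = ((free_flight x)%:E + gain jump_weight jump_target sol x)%E.
Proof.
apply: picard_limE.
- exact: measurable_jump_weight.
- exact: measurable_jump_target.
- exact: measurable_free_flight.
- exact: jump_weight_ge0.
- exact: free_flight_ge0.
Qed.

Lemma jump_weight_le x tau h' : jump_weight x tau h' <= 2 * 3.
Proof.
rewrite /jump_weight; case: ifP => [_|_]; last by rewrite mulr_ge0.
case: ifP => [_|_]; last by rewrite mulr_ge0.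
by rewrite ler_wpM2l//; apply: Pker_le3; exact: max0_ge0.
Qed.

(* Each collision multiplies the sup norm by at most [K], so [M * expR (K * t)] is a supersolution of Duhamel's equation. *)
Lemma sol_le : exists M K : R, [/\ 0 <= M, 0 <= K &
  forall x, (sol x <= (M * expR (K * `|time x|))%:E)%E].
Proof.
have [C C0 CE] := Efun_integral R.
have [p p0 wp] : exists2 p : R, 0 <= p & forall x tau h', jump_weight x tau h' <= p.
  by exists (2 * 3); [rewrite mulr_ge0|exact: jump_weight_le].
(* The rate is the bound on the jump density times the length of the interval of impact
   parameters. *)
pose K := p * (1 - -1); have K0 : 0 <= K by rewrite mulr_ge0//; lra.
have C0' := ltW C0.
exists C, K; split => //.
(* The absolute value keeps [G >= C] at negative times, where the gain vanishes and only the free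
   flight, at most [C], remains. *)
pose G (x : X) : \bar R := (C * expR (K * `|time x|))%:E.
have G0 x : (0 <= G x)%E by rewrite lee_fin mulr_ge0// expR_ge0.
have mG : measurable_fun setT G.
  apply/measurable_EFinP; apply: measurable_funM; first exact: measurable_cst.
  have mKt : measurable_fun setT (fun x : X => K * `|time x|).
    by apply: measurable_funM; [exact: measurable_cst|exact: measurable_abs].
  exact: (measurableT_comp (@measurable_expR R) mKt).
have mW := measurable_jump_weight; have mT := measurable_jump_target.
apply: (@picard_lim_le _ _ _ _ _ _ mW mT measurable_free_flight
  jump_weight_ge0 free_flight_ge0 G mG G0) => x.
have fC : free_flight x <= C.
  rewrite /free_flight; case: ifP => // h1.
  have [_ E0 EC] := CE _ _ (max0_ge0 (fly x + time x)) h1.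
  have /andP[b0 b1] := a01 (modang (ang x)).
  apply: (@le_trans _ _ (1 * (C * 1))); last by rewrite mul1r mulr1.
  apply: ler_pM => //; apply: le_trans EC _; apply: ler_wpM2l => //.
  by rewrite invf_le1 ?lerDl ?max0_ge0//; have := max0_ge0 (fly x + time x); lra.
have inner tau : (\int[mu]_h' ((jump_weight x tau h')%:E * G (jump_target x tau h'))
   <= if (0 <= tau <= time x)%R then (C * K * expR (K * tau))%:E else 0)%E.
  case: ifPn => [tt|tt]; last first.
    rewrite integral0_eq// => h' _.
    by rewrite /jump_weight (negbTE tt) mul0e.
  have -> : (\int[mu]_h' ((jump_weight x tau h')%:E * G (jump_target x tau h')) =
      \int[mu]_(h' in `[(-1)%R, 1%R])
        ((jump_weight x tau h')%:E * G (jump_target x tau h')))%E.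
    rewrite -integral_if_itv; apply: eq_integral => h' _.
    by case: ifPn => // hh; rewrite /jump_weight tt (negbTE hh) mul0e.
  rewrite (_ : C * K * expR (K * tau) = p * (C * expR (K * `|tau|)) * (1 - -1)).
    apply: ge0_integral_le_cst => //.
    - apply: measurable_funTS; exact: (measurable_gain_integrand1 mW mT mG).
    - move=> h' _; apply/andP; split.
        exact: (gain_integrand_ge0 jump_target jump_weight_ge0 G0).
      by rewrite /G -EFinM lee_fin ler_wpM2r// mulr_ge0// expR_ge0.
    - by apply: lebesgue_itv_cc; lra.
  by case/andP: tt => tau0 _; rewrite ger0_norm// /K; ring.
have [t0|t0] := leP 0 (time x); last first.
  rewrite (_ : gain _ _ _ _ = 0%E) ?adde0.
    apply: le_trans (_ : (C%:E <= _)%E); first by rewrite lee_fin.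
    rewrite lee_fin ler_peMr// -expR0 ler_expR mulr_ge0//.
  apply: integral0_eq => tau _; apply/eqP; rewrite eq_le.
  rewrite (gain_inner_ge0 jump_target jump_weight_ge0 G0) andbT.
  apply: le_trans (inner tau) _; case: ifPn => // /andP[t1 t2].
  by have := le_trans t1 t2; rewrite leNgt t0.
apply: (@le_trans _ _ (C%:E + \int[mu]_tau
    (if (0 <= tau <= time x)%R then (C * K * expR (K * tau))%:E else 0))%E).
  apply: leeD; first by rewrite lee_fin.
  apply: ge0_le_integral.
  - exact: measurableT.
  - by move=> tau _; exact: (gain_inner_ge0 jump_target jump_weight_ge0 G0).
  - exact: (measurable_gain_inner1 mW mT jump_weight_ge0 mG G0).
  - apply: measurable_fun_ifT; last exact: measurable_cst.
      apply: measurable_and.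
        by apply: measurable_fun_ler; [exact: measurable_cst|exact: measurable_id].
      by apply: measurable_fun_ler; [exact: measurable_id|exact: measurable_cst].
    apply/measurable_EFinP; apply: measurable_funM; first exact: measurable_cst.
    have mKt : measurable_fun setT (fun y : R => K * y).
      by apply: measurable_funM; [exact: measurable_cst|exact: measurable_id].
    exact: (measurableT_comp (@measurable_expR R) mKt).
  - by move=> tau _; exact: inner.
rewrite integral_if_itv integral_expR_0t// -EFinD lee_fin ger0_norm//.
by rewrite addrC subrK.
Qed.

End ConcreteSolution.

Lemma ge0_integrable (R : realType) (D : set R) (f : R -> R) :
  measurable D -> measurable_fun D (fun x => (f x)%:E) ->
  (forall x, D x -> 0 <= f x) ->
  (\int[@lebesgue_measure R]_(x in D) (f x)%:E < +oo)%E ->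
  (@lebesgue_measure R).-integrable D (fun x => (f x)%:E).
Proof.
move=> mD mf f0 fi; apply/integrableP; split; first exact: mf.
have -> // : (\int[@lebesgue_measure R]_(x in D) `|(f x)%:E| =
  \int[@lebesgue_measure R]_(x in D) (f x)%:E)%E.
by apply: eq_integral => x; rewrite inE => Dx; rewrite gee0_abs// lee_fin f0.
Qed.

(** * From the fixpoint to a real-valued mild solution *)

Section PhaseSolution.
Variable R : realType.
Local Notation mu := (@lebesgue_measure R).
Variable a : R -> R.
Hypothesis ma : measurable_fun setT a.
Hypothesis a01 : forall ph, 0 <= a ph <= 1.

(** Being constant in position, it is unaffected by transport along characteristics and by reduction
    to the torus; [fine] is faithful because [sol] is finite. *)
Definition phase_sol (t : R) : phase R :=
  fun _ _ ph s h => fine (sol a (t, ph, s, h)).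

Lemma sol_fin_num x : sol a x \is a fin_num.
Proof.
have [M [K [_ _ /(_ x) sx]]] := sol_le ma a01.
by rewrite ge0_fin_numE ?(sol_ge0 ma a01)//; apply: le_lt_trans sx _; rewrite ltry.
Qed.

Lemma measurable_phase_sol t : measurable_fun setT (fun p : R * R * R * R * R =>
  phase_sol t p.1.1.1.1 p.1.1.1.2 p.1.1.2 p.1.2 p.2).
Proof.
have m1 : measurable_fun setT (fun p : R * R * R * R * R => p.1).
  exact: measurable_fst.
have m11 : measurable_fun setT (fun p : R * R * R * R * R => p.1.1).
  exact: (measurableT_comp measurable_fst m1).
have mp : measurable_fun setT
    (fun p : R * R * R * R * R => (t, p.1.1.2, p.1.2, p.2)).
  apply: measurable_fun_pair; last exact: measurable_snd.
  apply: measurable_fun_pair; last exact: (measurableT_comp measurable_snd m1).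
  apply: measurable_fun_pair; first exact: measurable_cst.
  exact: (measurableT_comp measurable_snd m11).
have ms := measurableT_comp (measurable_sol ma a01) mp.
exact: (measurableT_comp (fine_measurable measurableT) ms).
Qed.

Section Duhamel.
Variables t x1 x2 ph s h : R.
Hypotheses (t0 : 0 <= t) (s0 : 0 <= s) (h1 : -1 <= h <= 1).
Let x : R * R * R * R := (t, ph, s, h).
Local Notation GI := (gain_integrand phase_sol t x1 x2 ph s h).
Local Notation inner tau := (\int[mu]_h'
  ((jump_weight x tau h')%:E * sol a (jump_target x tau h')))%E.

Let W0 := @jump_weight_ge0 R.
Let S0 := sol_ge0 ma a01.
Let mW := @measurable_jump_weight R.
Let mT := @measurable_jump_target R.
Let mS := measurable_sol ma a01.

(** On the domain of integration all cutoffs and clamps of the extended kernel are inactive. *)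
Lemma gain_integrandE tau h' : 0 <= tau <= t -> -1 <= h' <= 1 ->
  (GI tau h')%:E = ((jump_weight x tau h')%:E * sol a (jump_target x tau h'))%E.
Proof.
move=> tt hh; rewrite /gain_integrand /phase_sol EFinM.
rewrite fineK ?sol_fin_num// /jump_weight /jump_target /= tt hh.
rewrite clamped_thetaE// max_r//.
by case/andP: tt => _ tt; rewrite mulr_ge0// addr_ge0// subr_ge0.
Qed.

Lemma gain_integrand_nneg tau h' : 0 <= tau <= t -> -1 <= h' <= 1 ->
  0 <= GI tau h'.
Proof.
move=> tt hh; rewrite -lee_fin gain_integrandE//.
by apply: mule_ge0; [rewrite lee_fin; exact: W0|exact: S0].
Qed.

Lemma inner_gain_integrand tau : 0 <= tau <= t ->
  (\int[mu]_(h' in `[(-1)%R, 1%R]) (GI tau h')%:E = inner tau)%E.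
Proof.
move=> tt; rewrite -integral_if_itv; apply: eq_integral => h' _.
case: ifPn => hh; first exact: gain_integrandE.
by rewrite /jump_weight (negbTE hh) if_same mul0e.
Qed.

Lemma inner_ge0 tau : (0 <= inner tau)%E.
Proof. exact: (gain_inner_ge0 _ W0 S0). Qed.

Lemma measurable_GI tau : 0 <= tau <= t ->
  measurable_fun (`[(-1)%R, 1%R] : set R) (fun h' => (GI tau h')%:E).
Proof.
move=> tt; apply: (eq_measurable_fun
  (fun h' => (jump_weight x tau h')%:E * sol a (jump_target x tau h')))%E.
  by move=> h'; rewrite inE/= in_itv/= => hh; rewrite gain_integrandE.
apply: measurable_funTS; exact: (measurable_gain_integrand1 mW mT mS).
Qed.

Lemma inner_lty tau : 0 <= tau <= t -> (inner tau < +oo)%E.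
Proof.
move=> tt; have [M [K [M0 K0 sM]]] := sol_le ma a01.
have E0 : 0 <= expR (K * `|tau|) by exact: expR_ge0.
have [p p0 wp] : exists2 p : R, 0 <= p & forall x tau h', jump_weight x tau h' <= p.
  by exists (2 * 3); [rewrite mulr_ge0|exact: jump_weight_le].
rewrite -inner_gain_integrand//.
apply: (@le_lt_trans _ _ (p * (M * expR (K * `|tau|)) * (1 - -1))%:E); last exact: ltry.
apply: ge0_integral_le_cst; [exact: measurable_itv|exact: measurable_GI| |].
  move=> h'; rewrite /= in_itv/= => hh; apply/andP; split.
    by rewrite lee_fin gain_integrand_nneg.
  rewrite gain_integrandE// EFinM; apply: lee_pmul; [|exact: S0| |exact: sM].
    by rewrite lee_fin; exact: W0.
  by rewrite lee_fin; exact: wp.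
by apply: lebesgue_itv_cc; lra.
Qed.

Lemma Rintegral_GI tau : 0 <= tau <= t ->
  (Rintegral mu `[(-1)%R, 1%R] (GI tau))%:E = inner tau.
Proof.
move=> tt; rewrite -(inner_gain_integrand tt); apply: fineK.
rewrite inner_gain_integrand// ge0_fin_numE; first exact: inner_lty.
exact: inner_ge0.
Qed.

Lemma gain_solE : gain (@jump_weight R) (@jump_target R) (sol a) x =
  (\int[mu]_(tau in `[0%R, t])
     (Rintegral mu `[(-1)%R, 1%R] (GI tau))%:E)%E.
Proof.
rewrite -integral_if_itv; apply: eq_integral => tau _.
case: ifPn => tt; first by rewrite Rintegral_GI.
by apply: integral0_eq => h' _; rewrite /jump_weight /= (negbTE tt) mul0e.
Qed.

(** The gain is a summand of the finite [sol], the other summand being nonnegative. *)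
Lemma gain_sol_lty : (gain (@jump_weight R) (@jump_target R) (sol a) x < +oo)%E.
Proof.
apply: (@le_lt_trans _ _ (sol a x)); last by rewrite ltey_eq sol_fin_num.
by rewrite (solE ma a01 x) leeDr// lee_fin (free_flight_ge0 a01).
Qed.

Lemma phase_sol_duhamel :
  (forall tau, 0 <= tau <= t -> mu.-integrable `[(-1)%R, 1%R]
     (fun h' => (GI tau h')%:E)) /\
  mu.-integrable `[0%R, t]
    (fun tau => (Rintegral mu `[(-1)%R, 1%R] (GI tau))%:E) /\
  phase_sol t x1 x2 ph s h = a (modang ph) * Efun (s + t) h
    + Rintegral mu `[0%R, t] (fun tau => Rintegral mu `[(-1)%R, 1%R] (GI tau)).
Proof.
have RI0 tau : 0 <= tau <= t -> 0 <= Rintegral mu `[(-1)%R, 1%R] (GI tau).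
  by move=> tt; rewrite -lee_fin Rintegral_GI// inner_ge0.
split; [|split].
- move=> tau tt; apply: ge0_integrable; first exact: measurable_itv.
  + exact: measurable_GI.
  + by move=> h'; rewrite /= in_itv/= => hh; exact: gain_integrand_nneg.
  + by rewrite inner_gain_integrand// inner_lty.
- apply: ge0_integrable; first exact: measurable_itv.
  + apply: (eq_measurable_fun (fun tau => inner tau)).
      by move=> tau; rewrite inE/= in_itv/= => tt; rewrite Rintegral_GI.
    apply: measurable_funTS; exact: (measurable_gain_inner1 mW mT W0 mS S0).
  + by move=> tau; rewrite /= in_itv/= => tt; exact: RI0.
  + by rewrite -gain_solE gain_sol_lty.
- rewrite /phase_sol -/x (solE ma a01) fineD//; last first.
    rewrite ge0_fin_numE; first exact: gain_sol_lty.
    by apply: integral_ge0 => tau _; exact: inner_ge0.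
  congr (_ + _); last by rewrite gain_solE.
  by rewrite /free_flight /= h1 max_r// addr_ge0.
Qed.

End Duhamel.

Lemma phase_sol_is_solution : is_solution (fun _ _ ph => a ph) phase_sol.
Proof.
split; first by move=> t _; exact: measurable_phase_sol.
by move=> t x1 x2 ph s h t0 s0 h1; exact: phase_sol_duhamel.
Qed.

(** The nonnegative gain is dropped from Duhamel's formula. *)
Lemma phase_sol_ge t x1 x2 ph s h : 0 <= t -> 0 <= s -> -1 <= h <= 1 ->
  a (modang ph) * Efun (s + t) h <= phase_sol t x1 x2 ph s h.
Proof.
move=> t0 s0 h1; rewrite -lee_fin /phase_sol fineK ?sol_fin_num// (solE ma a01).
rewrite /free_flight /= h1 max_r ?addr_ge0// leeDl//.
apply: gain_ge0; [exact: jump_weight_ge0|exact: (sol_ge0 ma a01)].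
Qed.

Lemma phase_sol0 x1 x2 ph s h : 0 <= s -> -1 <= h <= 1 ->
  phase_sol 0 x1 x2 ph s h = a (modang ph) * Efun s h.
Proof.
move=> s0 h1; have [_ [_ ->]] := phase_sol_duhamel x1 x2 ph (lexx 0) s0 h1.
by rewrite addr0 set_itv1 Rintegral_set1 addr0.
Qed.

End PhaseSolution.

(** * Norms of the density and of the beam data *)

Section L2Norms.
Variable R : realType.
Local Notation mu := (@lebesgue_measure R).

Lemma measurable_integral_snd_in d (X : measurableType d) (D : set R)
    (g : X * R -> \bar R) : measurable D -> measurable_fun setT g ->
  (forall z, (0 <= g z)%E) ->
  measurable_fun setT (fun x => \int[mu]_(y in D) g (x, y))%E.
Proof.
move=> mD mg g0.
have -> : (fun x => \int[mu]_(y in D) g (x, y))%E =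
    (fun x => \int[mu]_y ((\1_D y : R)%:E * g (x, y)))%E.
  apply/funext => x; rewrite integral_mkcond; apply: eq_integral => y _.
  by rewrite patchE indicE; case: ifP => _; rewrite ?mul1e ?mul0e.
apply: (@measurable_integral_snd _ _ _ (fun q => (\1_D q.2 : R)%:E * g q)%E).
  apply: emeasurable_funM => //; apply/measurable_EFinP.
  exact: (measurableT_comp (measurable_indic mD) measurable_snd).
by move=> q; apply: mule_ge0 => //; rewrite lee_fin indicE.
Qed.

Lemma integral_unit_cst (r : \bar R) : (\int[mu]_(x in `[0%R, 1%R]) r = r)%E.
Proof.
transitivity (r * mu `[0%R, 1%R])%E; first exact: integral_cst.
by rewrite lebesgue_itv_cc// subr0 mule1.
Qed.

Definition density_L2sq : \bar R :=
  (\int[mu]_(s in `[0%R, +oo[) \int[mu]_(h in `[(-1)%R, 1%R])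
     ((Efun s h) ^+ 2)%R%:E)%E.

Lemma measurable_Efun2 (s : R) (D : set R) : 0 <= s ->
  measurable_fun D (fun h => ((Efun s h) ^+ 2)%:E).
Proof.
move=> s0; apply/measurable_EFinP/measurable_funTS/measurable_funX.
have mE := measurableT_comp (@measurable_Efun R) (pair1_measurable s).
by apply: (eq_measurable_fun _ _ mE) => h _ /=; rewrite max_r.
Qed.

(** The decay of [E] like [(1 + s)^-1] is square integrable in [s], and [h] ranges over a bounded
    interval. *)
Lemma density_L2sq_fin : exists2 q : R, 0 <= q & density_L2sq = q%:E.
Proof.
have [C C0 CE] := Efun_integral R.
have C0' := ltW C0.
have D0 : (0 <= density_L2sq)%E.
  by apply: integral_ge0 => s _; apply: integral_ge0 => h _; rewrite lee_fin sqr_ge0.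
pose K := C ^+ 2 * (1 - -1); have K0 : 0 <= K by rewrite mulr_ge0 ?sqr_ge0//; lra.
suff DK : (density_L2sq <= (K * (1 + 0)^-1)%:E)%E.
  exists (fine density_L2sq); first exact: fine_ge0.
  rewrite fineK// ge0_fin_numE//; apply: le_lt_trans DK _; exact: ltry.
have mi : measurable_fun (`[0, +oo[ : set R) (fun s => (((1 + s) ^+ 2)^-1)%:E).
  apply/measurable_EFinP/measurable_funTS.
  apply: measurable_inv_ge0; first by move=> x; exact: sqr_ge0.
  by apply: measurable_funX; apply: measurable_funD => //; exact: measurable_cst.
apply: (@le_trans _ _ (\int[mu]_(s in `[0%R, +oo[)
    (K%:E * (((1 + s) ^+ 2)^-1)%:E))%E); last first.
  rewrite (@ge0_integralZl _ _ _ mu _ (measurable_itv `[0, +oo[) _ mi); first last.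
  - by rewrite lee_fin.
  - by move=> s _; rewrite lee_fin invr_ge0 sqr_ge0.
  by rewrite integral_inv_sqr1D// -EFinM.
apply: ge0_le_integral; first exact: measurable_itv.
- by move=> s _; apply: integral_ge0 => h _; rewrite lee_fin sqr_ge0.
- have m2 : measurable_fun setT
      (fun q : R * R => ((Efun (Num.max 0 q.1) q.2) ^+ 2)%:E).
    by apply/measurable_EFinP/measurable_funX; exact: measurable_Efun.
  have m3 := @measurable_integral_snd_in _ _ `[(-1)%R, 1%R]%classic _
    (measurable_itv _) m2 (fun z => sqr_ge0 _).
  apply: (eq_measurable_fun _ _ (measurable_funTS m3)) => s.
  rewrite inE/= in_itv/= andbT => s0; apply: eq_integral => h _.
  by rewrite /= max_r.
- by apply: emeasurable_funM => //; exact: measurable_cst.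
move=> s; rewrite /= in_itv/= andbT => s0.
rewrite -EFinM (_ : K * _ = (C * (1 + s)^-1) ^+ 2 * (1 - -1)); last first.
  by rewrite /K exprMn exprVn; ring.
apply: ge0_integral_le_cst; first exact: measurable_itv.
- exact: measurable_Efun2.
- move=> h; rewrite /= in_itv/= => h1; rewrite !lee_fin sqr_ge0/=.
  have [_ E0 EC] := CE _ _ s0 h1.
  by rewrite ler_sqr ?nnegrE//; exact: le_trans EC.
- by apply: lebesgue_itv_cc; lra.
Qed.

Section Beam.
Variable e : R.
Hypothesis e02 : 0 < e < 2 * pi.

(** The interval is open at [0] because [modang] sends [2 * pi] to [0]: the beam vanishes at both
    ends of [[0, 2 * pi]], so it is unchanged by angle reduction there. *)
Definition beam (ph : R) : R := \1_(`]0, e]) ph.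

Lemma beamE ph : beam ph = (0 < ph <= e)%R%:R.
Proof.
rewrite /beam indicE; congr (_%:R); apply: (congr1 nat_of_bool).
by apply/idP/idP; rewrite inE/= in_itv.
Qed.

Lemma beam01 ph : 0 <= beam ph <= 1.
Proof. by rewrite beamE; case: (_ < _ <= _); rewrite /= ?lexx ?ler01. Qed.

Lemma measurable_beam : measurable_fun setT beam.
Proof. exact: measurable_indic. Qed.

Lemma beam_modang ph : 0 <= ph <= 2 * pi -> beam (modang ph) = beam ph.
Proof.
move=> /andP[p0]; rewrite le_eqVlt => /orP[/eqP ->|p2].
  rewrite modang_2pi !beamE ltxx; case/andP: e02 => e0 e2.
  by rewrite [2 * pi <= e]leNgt e2 andbF.
by rewrite modang_id// p0.
Qed.

Lemma integral_beam (q : R) : 0 <= q ->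
  (\int[mu]_(ph in `[0%R, (2 * pi)%R]) (q%:E * (beam ph)%:E) = (q * e)%:E)%E.
Proof.
move=> q0; rewrite ge0_integralZl; first last.
- by rewrite lee_fin.
- by move=> ph _; rewrite lee_fin; case/andP: (beam01 ph).
- by apply/measurable_EFinP/measurable_funTS; exact: measurable_beam.
- exact: measurable_itv.
rewrite integral_indic; [|exact: measurable_itv|exact: measurable_itv].
have AE : `]0, e]%classic `&` `[0, 2 * pi]%classic = `]0, e]%classic :> set R.
  apply/seteqP; split => ph /=; rewrite !in_itv/=; first by case.
  case/andP: e02 => e0 e2 /andP[p0 pe]; split; first by rewrite p0.
  by rewrite ltW//= (le_trans pe)// ltW.
have Ae : (mu (`]0, e]%classic : set R) = e%:E).
  by rewrite lebesgue_measure_itv/= lte_fin; case/andP: e02 => -> _; rewrite sube0.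
by rewrite EFinM -Ae -[in RHS]AE.
Qed.

Lemma beam_in_L2 : in_L2_T2S1 (fun _ _ ph => beam ph).
Proof.
split; first exact: (measurableT_comp measurable_beam measurable_snd).
have -> : (\int[mu]_(ph in `[0%R, (2 * pi)%R]) ((beam ph) ^+ 2)%R%:E = e%:E)%E.
  rewrite -[e]mul1r -integral_beam//; apply: eq_integral => ph _.
  by rewrite mul1e beamE; case: (_ < _ <= _); rewrite ?expr1n ?expr0n.
by rewrite !integral_unit_cst ltry.
Qed.

Lemma avg_beam : avg (fun _ _ ph => beam ph) = (2 * pi)^-1 * e.
Proof.
rewrite /avg; congr (_ * _).
have -> : Rintegral mu `[0%R, (2 * pi)%R] (fun ph => beam ph) = e.
  rewrite /Rintegral -[RHS]/(fine e%:E); congr fine.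
  rewrite -[in RHS](mul1r e) -integral_beam//; apply: eq_integral => ph _.
  by rewrite mul1e.
by rewrite /Rintegral !integral_unit_cst.
Qed.

(** At time [0] the solution is the beam times [E]. The beam is its own square, so the integral
    factorises into [e] and the squared norm of [E]. *)
Lemma L2sq_phase_sol0 (q : R) : 0 <= q -> density_L2sq = q%:E ->
  L2sq (phase_sol beam 0) = (q * e)%:E.
Proof.
move=> q0 qE; rewrite /L2sq.
transitivity (\int[mu]_(x1 in `[0%R, 1%R]) \int[mu]_(x2 in `[0%R, 1%R])
  (q * e)%:E)%E; last by rewrite !integral_unit_cst.
apply: eq_integral => x1 _; apply: eq_integral => x2 _.
rewrite -integral_beam//; apply: eq_integral => ph.
rewrite inE/= in_itv/= => ph2.
have -> : (\int[mu]_(s in `[0%R, +oo[) \int[mu]_(h in `[(-1)%R, 1%R])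
    ((phase_sol beam 0 x1 x2 ph s h) ^+ 2)%R%:E =
  \int[mu]_(s in `[0%R, +oo[) \int[mu]_(h in `[(-1)%R, 1%R])
    ((beam ph * Efun s h) ^+ 2)%R%:E)%E.
  apply: eq_integral => s; rewrite inE/= in_itv/= andbT => s0.
  apply: eq_integral => h; rewrite inE/= in_itv/= => h1.
  by rewrite (phase_sol0 measurable_beam beam01)// beam_modang.
rewrite beamE; case: (_ < _ <= _); rewrite /= ?mule1 ?mule0.
  rewrite -qE; apply: eq_integral => s _; apply: eq_integral => h _.
  by rewrite mul1r.
by apply: integral0_eq => s _; apply: integral0_eq => h _; rewrite mul0r expr0n.
Qed.

End Beam.
End L2Norms.

(** * Lower bound on the distance to equilibrium *)

Section LowerBound.
Variable R : realType.
Local Notation mu := (@lebesgue_measure R).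

(** Restrict to angles in []0, e]], [s] in [[t, 2 * t]] and [1 - h <= (24 * t)^-1]. There [s + t]
    lies in [[2 * t, 3 * t]], so the solution is at least [c / t], while the equilibrium is at most
    [e * C <= c / t / 2]. The squared gap is integrated over a box with sides [e], [t] and
    [(24 * t)^-1]. *)
Lemma L2sq_phase_sol_lower (e t c C : R) : 0 < e <= 1 -> 1 <= t -> 0 < c ->
  (forall s h, 2 * t <= s <= 3 * t -> 1 - (24 * t)^-1 <= h <= 1 ->
    c / t <= Efun s h) ->
  (forall s h, 0 <= s -> -1 <= h <= 1 -> 0 <= Efun s h <= C) ->
  e * C <= c / t / 2 ->
  (((c / t / 2) ^+ 2 * (24 * t)^-1 * t * e)%:E <=
   L2sq (fun x1 x2 ph s h => phase_sol (beam e) t x1 x2 ph s h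
     - avg (fun _ _ ph => beam e ph) * Efun s h)%R)%E.
Proof.
move=> /andP[e0 e1] t1 c0 Elow Eup eC.
have t0 : 0 < t by lra.
have pi2 := pi_ge2 R.
have e02 : 0 < e < 2 * pi by lra.
have mb := measurable_beam e; have b01 := beam01 e.
set A := avg _.
have A0 : 0 <= A by rewrite /A avg_beam// mulr_ge0 ?invr_ge0//; lra.
(* The average is [e / (2 * pi)]. *)
have Ae : A <= e.
  rewrite /A avg_beam// ler_piMl ?(ltW e0)// invf_le1; lra.
(* Position is frozen at the origin and [s] truncated at [0], which gives a measurable integrand in
   three variables with the same values on the domain. *)
pose g (q : R * R * R) : \bar R :=
  ((phase_sol (beam e) t 0 0 q.1.1 q.1.2 q.2 - A * Efun (Num.max 0 q.1.2) q.2) ^+ 2)%:E.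
have m1 : measurable_fun setT (fun q : R * R * R => q.1) by exact: measurable_fst.
have m11 : measurable_fun setT (fun q : R * R * R => q.1.1).
  exact: (measurableT_comp measurable_fst m1).
have m12 : measurable_fun setT (fun q : R * R * R => q.1.2).
  exact: (measurableT_comp measurable_snd m1).
have mg : measurable_fun setT g.
  apply/measurable_EFinP/measurable_funX/measurable_funB.
    have mp : measurable_fun setT
        (fun q : R * R * R => (0 : R, 0 : R, q.1.1, q.1.2, q.2)).
      apply: measurable_fun_pair; last exact: measurable_snd.
      apply: measurable_fun_pair; last exact: m12.
      by apply: measurable_fun_pair; [exact: measurable_cst|exact: m11].
    exact: (measurableT_comp (measurable_phase_sol mb b01 t) mp).
  apply: measurable_funM; first exact: measurable_cst.
  have mp : measurable_fun setT (fun q : R * R * R => (q.1.2, q.2)).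
    by apply: measurable_fun_pair; [exact: m12|exact: measurable_snd].
  exact: (measurableT_comp (@measurable_Efun R) mp).
have g0 q : (0 <= g q)%E by rewrite lee_fin sqr_ge0.
pose I1 (q : R * R) := (\int[mu]_(h in `[(-1)%R, 1%R]) g (q, h))%E.
have mI1 : measurable_fun setT I1.
  exact: measurable_integral_snd_in (measurable_itv _) mg g0.
have I10 q : (0 <= I1 q)%E by exact: integral_ge0.
pose I2 ph := (\int[mu]_(s in `[0%R, +oo[) I1 (ph, s))%E.
have mI2 : measurable_fun setT I2.
  exact: measurable_integral_snd_in (measurable_itv _) mI1 I10.
have I20 ph : (0 <= I2 ph)%E by exact: integral_ge0.
have a0 : 0 < (24 * t)^-1 by rewrite invr_gt0; lra.
have a1 : (24 * t)^-1 <= 1 by rewrite invf_le1; lra.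
have ct0 : 0 < c / t / 2 by rewrite !divr_gt0.
have P1 : 0 <= (c / t / 2) ^+ 2 * (24 * t)^-1 by exact: (mulr_ge0 (sqr_ge0 _) (ltW a0)).
have LE : L2sq (fun x1 x2 ph s h => phase_sol (beam e) t x1 x2 ph s h - A * Efun s h)%R =
    (\int[mu]_(ph in `[0%R, (2 * pi)%R]) I2 ph)%E.
  transitivity (\int[mu]_(x1 in `[0%R, 1%R]) \int[mu]_(x2 in `[0%R, 1%R])
    \int[mu]_(ph in `[0%R, (2 * pi)%R]) I2 ph)%E; last by rewrite !integral_unit_cst.
  apply: eq_integral => x1 _; apply: eq_integral => x2 _.
  apply: eq_integral => ph _; apply: eq_integral => s.
  rewrite inE/= in_itv/= andbT => s0; apply: eq_integral => h _.
  by rewrite /g /= max_r.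
rewrite LE; apply: (@ge0_integral_ge_cst _ _ `]0, e]%classic).
- exact: measurable_itv.
- exact: measurable_itv.
- by move=> ph /=; rewrite !in_itv/=; lra.
- exact: (mulr_ge0 P1 (ltW t0)).
- exact: measurable_funTS.
- by move=> ph _; exact: I20.
- move=> ph; rewrite /= in_itv/= => phe.
  have bph : beam e (modang ph) = 1.
    have php : 0 <= ph <= 2 * pi by lra.
    rewrite (beam_modang e02 php) beamE phe; reflexivity.
  apply: (@ge0_integral_ge_cst _ _ `[t, 2 * t]%classic).
  + exact: measurable_itv.
  + exact: measurable_itv.
  + by move=> s /=; rewrite !in_itv/= andbT; lra.
  + exact: P1.
  + by apply: measurable_funTS; exact: (measurableT_comp mI1 (pair1_measurable ph)).
  + by move=> s _; exact: I10.
  + move=> s; rewrite /= in_itv/= => st; have s0 : 0 <= s by lra.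
    apply: (@ge0_integral_ge_cst _ _ `[1 - (24 * t)^-1, 1]%classic).
    * exact: measurable_itv.
    * exact: measurable_itv.
    * by move=> h /=; rewrite !in_itv/=; lra.
    * exact: sqr_ge0.
    * by apply: measurable_funTS; exact: (measurableT_comp mg (pair1_measurable (ph, s))).
    * by move=> h _; exact: g0.
    * move=> h; rewrite /= in_itv/= => hh; have h1 : -1 <= h <= 1 by lra.
      have Fge := phase_sol_ge mb b01 0 0 ph (ltW t0) s0 h1.
      rewrite bph mul1r in Fge.
      have El : c / t <= Efun (s + t) h by apply: Elow hh; lra.
      have /andP[E0 EC] := Eup _ _ s0 h1.
      have AE : A * Efun s h <= c / t / 2.
        by apply: le_trans eC; apply: ler_pM.
      have L : c / t / 2 <= phase_sol (beam e) t 0 0 ph s h - A * Efun s h by lra.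
      rewrite lee_fin /= (max_r s0) !expr2.
      exact: (ler_pM (ltW ct0) (ltW ct0) L L).
    * by rewrite lebesgue_itv_cc; [congr (_%:E); lra|lra].
  + by rewrite lebesgue_itv_cc; [congr (_%:E); lra|lra].
- by rewrite lebesgue_measure_itv/= lte_fin e0 sube0.
Qed.

End LowerBound.

(** * Contradiction with the assumed decay rate *)

Unset Implicit Arguments.

Theorem theorem3p5 (R : realType) :
  ~ exists Phi : R -> R,
      littleo_t32 Phi /\
      forall f : R -> R -> R -> R, in_L2_T2S1 f ->
      forall F : R -> phase R, is_solution f F ->
      forall t : R, 0 <= t ->
        (L2norm (fun x1 x2 ph s h => (F t x1 x2 ph s h - avg f * Efun s h)%R)
         <= (Phi t)%:E * L2norm (F 0%R))%E.
Proof.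
move=> [Phi [Phio H]].
have [C C0 CE] := Efun_integral R.
have [c c0 cE] := Efun_lower R.
have [q q0 qE] := density_L2sq_fin R.
(* The lower bound for the squared distance reads [k * (e / t ^+ 2)]. *)
pose k := (c / 2) ^+ 2 / 24.
have k0 : 0 < k by rewrite divr_gt0// exprn_gt0// divr_gt0.
(* Chosen so that [d ^+ 2 * q < k]; the [+ 1] makes the inequality strict and covers [q = 0]. *)
pose d := Num.sqrt (k / (q + 1)).
have kq0 : 0 < k / (q + 1) by rewrite divr_gt0//; lra.
have d0 : 0 < d by rewrite sqrtr_gt0.
have dk : d ^+ 2 * q < k.
  rewrite sqr_sqrtr ?(ltW kq0)// mulrAC ltr_pdivrMr; last by lra.
  by rewrite ltr_pM2l//; lra.
have [M PM] := Phio d d0.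
pose t := Num.max M 1.
have t1 : 1 <= t by rewrite le_max lexx orbT.
have t0 : 0 < t by lra.
(* For [t >= 1] the power [-3/2] is at most the power [-1], and the latter already suffices. *)
have Pt : `|Phi t| <= d / t.
  have Mt : M <= t by rewrite le_max lexx.
  apply: le_trans (PM t Mt) _; apply: ler_wpM2l; first exact: ltW.
  have <- : t `^ (-1) = t^-1 by rewrite powR_inv1// ltW.
  by apply: ler_powR; [exact: t1|lra].
(* The beam width depends on [t]: narrow enough that the equilibrium stays below half of the
   free-flight term. *)
pose e := Num.min 1 (c / t / 2 / C).
have ct0 : 0 < c / t / 2 by rewrite !divr_gt0.
have e0 : 0 < e by rewrite lt_min ltr01 divr_gt0.
have e1 : e <= 1 by rewrite ge_min lexx.
have eC : e * C <= c / t / 2 by rewrite -ler_pdivlMr// ge_min lexx orbT.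
have e02 : 0 < e < 2 * pi by have := pi_ge2 R; lra.
have e01 : 0 < e <= 1 by rewrite e0.
have Eup s h : 0 <= s -> -1 <= h <= 1 -> 0 <= Efun s h <= C.
  move=> s0 h1; have [_ E0 E1] := CE _ _ s0 h1; rewrite E0/=.
  apply: le_trans E1 _; rewrite ler_piMr ?(ltW C0)// invf_le1; lra.
have low := L2sq_phase_sol_lower e01 t1 c0 (fun s h => cE t s h t1) Eup eC.
have mb := measurable_beam e; have b01 := beam01 e.
have := H _ (beam_in_L2 e02) _ (phase_sol_is_solution mb b01) t (ltW t0).
rewrite /L2norm (L2sq_phase_sol0 e02 q0 qE) -EFinM.
(* An infinite distance contradicts the finite upper bound, and the value [-oo] contradicts the
   lower bound. *)
case: (L2sq _) low => [r|//|//]; rewrite !lee_fin => low up.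
have a0 : 0 <= (24 * t)^-1 by rewrite invr_ge0; lra.
have r0 : 0 <= r.
  apply: le_trans low.
  exact: (mulr_ge0 (mulr_ge0 (mulr_ge0 (sqr_ge0 _) a0) (ltW t0)) (ltW e0)).
have : Num.sqrt r <= d / t * Num.sqrt (q * e).
  apply: le_trans up _; apply: ler_wpM2r; first exact: sqrtr_ge0.
  by apply: le_trans Pt; exact: ler_norm.
have qe0 : 0 <= q * e by rewrite mulr_ge0// ltW.
rewrite -ler_sqr ?nnegrE ?sqrtr_ge0//; last first.
  by rewrite mulr_ge0 ?sqrtr_ge0// divr_ge0// ltW.
rewrite exprMn !sqr_sqrtr// => /(le_trans low).
(* Both squared bounds carry the factor [e / t ^+ 2]; cancelling it leaves [k <= d ^+ 2 * q],
   against the choice of [d]. *)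
have -> : (c / t / 2) ^+ 2 * (24 * t)^-1 * t * e = k * (e / t ^+ 2).
  by rewrite /k; field; lra.
have -> : (d / t) ^+ 2 * (q * e) = d ^+ 2 * q * (e / t ^+ 2) by field; lra.
rewrite ler_pM2r; last by rewrite divr_gt0// exprn_gt0.
by rewrite leNgt dk.
Qed.
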